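(* Let $p$ be a prime and let $F$ be an algebraic closure of $\mathbb{F}_p$. Let $R$ be the coordinate ring of a smooth affine irreducible curve $\mathcal{C}$ over $F$ and let $A, B \in R\setminus F$. Let $N_0 \in \mathbb{N}$. The following hold: (1) Suppose that for all $n \in \mathbb{N}$ with $n > N_0$, every prime ideal of $R$ that divides $A^n - 1$ also divides $B^n - 1$. Then $B^{p^m} = A^k$ for some $k \in \mathbb{Z}\setminus\{0\}$ and $m \in \mathbb{Z}_{\geq 0}$. (2) Suppose that for all $n \in \mathbb{N}$ with $n > N_0$, every prime ideal of $R$ that divides $\Psi_n(A)$ also divides $\Psi_n(B)$. Then either $B = A^{\pm p^{m}}$ or $A = B^{\pm p^m}$ for some $m \in \mathbb{Z}_{\geq 0}$ and some choice of sign.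
   Context: $\mathbb{N} = \{1,2,\ldots\}$. For $n \in \mathbb{N}$, $\Psi_n(T) \in \mathbb{Z}[T]$ denotes the $n$-th cyclotomic polynomial, viewed as a polynomial over $R$ via the unique ring homomorphism $\mathbb{Z} \to R$. A prime ideal $\mathfrak{p}$ of $R$ divides $f \in R$ if $f \in \mathfrak{p}$. Negative powers of $A$ or $B$ are taken in the fraction field of $R$. *)

(* Defs.v *)
From HB Require Import structures.
From mathcomp Require Import all_boot all_order all_algebra all_field.
From mathcomp Require Import ring_quotient fraction cyclotomic.
From mathcomp Require Import mpoly.

Set Implicit Arguments.
Unset Strict Implicit.
Unset Printing Implicit Defensive.

Import GRing.Theory.
Local Open Scope ring_scope.

(* Classical affine geometry in F^n; it is meant for an algebraically closed
   field F, over which an affine variety is determined by its set of F-points. *)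

Definition zariski_closed (F : fieldType) (n : nat)
    (C : {ffun 'I_n -> F} -> Prop) : Prop :=
  exists S : {mpoly F[n]} -> Prop,
    forall x, C x <-> (forall f, S f -> f.@[x] = 0).

Definition vanishing_ideal (F : fieldType) (n : nat)
    (C : {ffun 'I_n -> F} -> Prop) (f : {mpoly F[n]}) : Prop :=
  forall x, C x -> f.@[x] = 0.

Definition zariski_irreducible (F : fieldType) (n : nat)
    (C : {ffun 'I_n -> F} -> Prop) : Prop :=
  (exists x, C x) /\
  forall C1 C2 : {ffun 'I_n -> F} -> Prop,
    zariski_closed C1 -> zariski_closed C2 ->
    (forall x, C x -> C1 x \/ C2 x) ->
    (forall x, C x -> C1 x) \/ (forall x, C x -> C2 x).

(* Z 0 < Z 1 < ... < Z d, a chain of length d of irreducible closed subsets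
   of the closed set C. *)
Definition has_irreducible_chain (F : fieldType) (n : nat)
    (C : {ffun 'I_n -> F} -> Prop) (d : nat) : Prop :=
  exists Z : nat -> {ffun 'I_n -> F} -> Prop,
    (forall i, (i <= d)%N ->
       [/\ zariski_closed (Z i), zariski_irreducible (Z i)
         & forall x, Z i x -> C x]) /\
    (forall i, (i < d)%N ->
       (forall x, Z i x -> Z i.+1 x) /\ (exists x, Z i.+1 x /\ ~ Z i x)).

Definition has_zariski_dim (F : fieldType) (n : nat)
    (C : {ffun 'I_n -> F} -> Prop) (d : nat) : Prop :=
  has_irreducible_chain C d /\ ~ has_irreducible_chain C d.+1.

Definition generates_ideal (F : fieldType) (n t : nat)
    (f : 'I_t -> {mpoly F[n]}) (I : {mpoly F[n]} -> Prop) : Prop :=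
  forall g, I g <-> exists h : 'I_t -> {mpoly F[n]}, g = \sum_(i < t) h i * f i.

(* Jacobian criterion: the rank is n - d at every point.  The rank depends only
   on the ideal, so one system of generators is as good as any other. *)
Definition smooth_of_dim (F : fieldType) (n : nat)
    (C : {ffun 'I_n -> F} -> Prop) (d : nat) : Prop :=
  exists (t : nat) (f : 'I_t -> {mpoly F[n]}),
    generates_ideal f (vanishing_ideal C) /\
    forall x, C x ->
      (\rank (\matrix_(i < t, j < n) ((f i)^`M(j)).@[x]) + d = n)%N.

Definition smooth_irreducible_affine_curve (F : fieldType) (n : nat)
    (C : {ffun 'I_n -> F} -> Prop) : Prop :=
  [/\ zariski_closed C, zariski_irreducible C,
      has_zariski_dim C 1 & smooth_of_dim C 1].

(* R, with structure map iota, is isomorphic as an F-algebra to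
   F[X_1, ..., X_n] modulo the vanishing ideal of C. *)
Definition is_coordinate_ring (F : fieldType) (R : idomainType)
    (iota : {rmorphism F -> R}) (n : nat)
    (C : {ffun 'I_n -> F} -> Prop) : Prop :=
  exists pi : {rmorphism {mpoly F[n]} -> R},
    [/\ forall c : F, pi c%:MP = iota c,
        forall a : R, exists f, pi f = a
      & forall f, pi f = 0 <-> vanishing_ideal C f].

(* The structure map j makes the closed field F an algebraic closure of 'F_p. *)
Definition is_algebraic_closure_of_Fp (p : nat) (F : closedFieldType)
    (j : {rmorphism 'F_p -> F}) : Prop :=
  forall x : F, algebraicOver j x.

Definition cyclotomic_value (R : nzRingType) (n : nat) (a : R) : R :=
  (map_poly intr 'Phi_n).[a].

(* Main.v *)
Require Import Defs.
From HB Require Import structures.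
From mathcomp Require Import all_boot all_order all_algebra all_field.
From mathcomp Require Import ring_quotient fraction cyclotomic.
From mathcomp Require Import mpoly.
From mathcomp Require Import cyclic zify.
From Stdlib Require Import Classical ClassicalEpsilon.

(** The points of the curve enter only as the homomorphisms [x : R -> F] of
    [F]-algebras; the kernel of each is a prime ideal of [R]. Every nonzero
    element of [F] is a root of unity of order prime to [p], so the first
    divisibility hypothesis says that [x B] is a power of [x A] whenever [x A]
    is nonzero. In the second one, [Phi_(n p^e)] is modulo [p] a power of
    [Phi_n] when [p] does not divide [n], and so the hypothesis, which concerns
    large indices only, still says that [x A] and [x B] have the same order
    (lemmas [cyclotomic_root_primitive] and [primitive_cyclotomic_root]).

    The heart of the proof is a multiplicative relation between [A] and [B]
    (lemma [multiplicative_relation]). As the curve has dimension one, [A] and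
    [B] satisfy a polynomial equation [f(A, B) = 0]. The finitely many
    coefficients of [f] lie in a finite field, and are fixed by [y |-> y^Q] for
    some power [Q] of [p]. Let [n] be a high power of a prime [l] other than
    [p], and choose [x] such that [alpha = x A] has order [n]; this is possible
    since [A] takes almost every value. Then [beta = x B] is a power of
    [alpha], and the box principle gives exponents at most [M], with [M] about
    the square root of [n], such that
    [alpha^i1 beta^j1 = alpha^i2 beta^j2]. This equation and [f = 0] hold at
    all the conjugates [(alpha^(Q^t), beta^(Q^t))]. The order of [Q] modulo [n]
    is at least a constant multiple of [n] (lemma [order_growth]), so these are
    more points than the Bezout bound, of order [M], allows two curves without
    a common component. As [f] is irreducible over [F(X)], it divides
    [X^i1 Y^j1 - X^i2 Y^j2], whence [A^i1 B^j1 = A^i2 B^j2].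

    It remains to clean up a relation [B^v = A^k]. Specialising [A] to roots of
    unity of suitable orders shows that the part [v'] of [v] prime to [p]
    divides [k], and that the [v']-th root of unity which appears when the
    [v']-th root of the relation is taken is [1] (lemma [power_relation]). If
    specialisation preserves the order, the same method shows that [k] is up to
    sign a power of [p] (lemma [primitive_power_relation]), and one cancels the
    Frobenius.

    The two facts of geometry that are used, that [A] takes almost every value
    and that [A] and [B] are algebraically dependent, both come from one
    theorem on the extension of specialisations ([extension_theorem]). Were [A]
    and [B] independent, one could specialise one of them to a constant while
    the other stays transcendental; the zero locus of the kernel would lie
    strictly between a point and the curve. *)

Set Implicit Arguments.
Unset Strict Implicit.
Unset Printing Implicit Defensive.

Import GRing.Theory.
Local Open Scope ring_scope.

(** * The extension step *)

Lemma exists_minimal (T : Type) (P : T -> Prop) (sz : T -> nat) :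
  (exists x, P x) -> exists x, P x /\ forall y, P y -> (sz x <= sz y)%N.
Proof.
case=> x0; have [n] := ubnP (sz x0); elim: n x0 => // n IHn x0 lt_x0n Px0.
have [[y [Py lt_yx]]|no_y] := classic (exists y, P y /\ (sz y < sz x0)%N).
  by apply: (IHn y) => //; apply: leq_trans lt_yx _; rewrite -ltnS.
exists x0; split=> // y Py; rewrite leqNgt; apply/negP=> lt_yx.
by apply: no_y; exists y.
Qed.

Section MinimalGenerator.
Variables (S R : idomainType) (e : {rmorphism S -> R}).

(** Dropping the leading terms that [e] kills makes degrees before and after
    [e] agree. *)
Lemma truncate_kernel (q : {poly S}) : map_poly e q != 0 ->
  exists q0, map_poly e q0 = map_poly e q /\ e (lead_coef q0) != 0.
Proof.
move=> nz_eq; pose m := size (map_poly e q).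
have m_gt0 : (0 < m)%N by rewrite size_poly_gt0.
pose q0 := \poly_(i < m) q`_i; exists q0.
have coef_m : e q`_m.-1 != 0 by rewrite -coef_map -lead_coefE lead_coef_eq0.
have sz_q0 : size q0 = m.
  rewrite size_poly_eq //; move: coef_m.
  by apply: contraNneq => ->; rewrite ?rmorph0 ?eqxx.
split.
  apply/polyP=> i; rewrite !coef_map coef_poly; case: ltnP => // le_mi.
  by rewrite raddf0 -coef_map nth_default.
by rewrite lead_coefE sz_q0 coef_poly prednK // leqnn.
Qed.

Lemma map_lead_neq0_size (q : {poly S}) :
  e (lead_coef q) != 0 -> size (map_poly e q) = size q.
Proof. exact: size_map_poly_id0. Qed.

(** Pseudo-division in [S[Y]] makes an element whose image has least degree a
    generator, up to powers of its leading coefficient. The morphism [e] need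
    not be injective: the second hypothesis says that the ideal [P] contains the
    polynomials with coefficients in the kernel. *)
Lemma minimal_generator (P : {poly S} -> Prop) :
    (forall c h p q, P p -> P q -> P (c *: p - h * q)) ->
    (forall p q, map_poly e p = map_poly e q -> P p -> P q) ->
    (exists q, P q /\ map_poly e q != 0) ->
  exists q, [/\ P q, e (lead_coef q) != 0 &
    forall p, P p -> exists N h,
      map_poly e (lead_coef q ^+ N *: p) = map_poly e (h * q)].
Proof.
move=> Pideal Pker /(exists_minimal (fun q => size (map_poly e q))).
case=> q1 [[Pq1 nz_q1] min_q1].
have [q [eq_q lead_q]] := truncate_kernel nz_q1.
have Pq : P q by apply: Pker Pq1.
exists q; split=> // p Pp; exists (scalp p q), (p %/ q).
have nz_q : q != 0.
  by apply: contraNneq lead_q => ->; rewrite lead_coef0 rmorph0.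
have Dr : p %% q = lead_coef q ^+ scalp p q *: p - (p %/ q) * q.
  by rewrite Pdiv.Idomain.divp_eq addrAC subrr add0r.
apply/eqP; rewrite -subr_eq0 -rmorphB -Dr; apply: contraT => nz_r.
have Pr : P (p %% q) by rewrite Dr; apply: Pideal.
have := min_q1 _ (conj Pr nz_r).
rewrite -eq_q map_lead_neq0_size // leqNgt => /negP[].
by apply: leq_ltn_trans (size_poly _ _) _; rewrite ltn_modp.
Qed.

End MinimalGenerator.

Lemma map_poly_kernel (S R L : idomainType) (e : {rmorphism S -> R})
    (phi : {rmorphism S -> L}) (p q : {poly S}) :
  (forall s, e s = 0 -> phi s = 0) ->
  map_poly e p = map_poly e q -> map_poly phi p = map_poly phi q.
Proof.
move=> kphi /polyP eq_pq; apply/polyP=> i; apply/eqP.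
rewrite -subr_eq0 -coefB -rmorphB coef_map /= kphi //.
rewrite -[LHS]coef_map rmorphB coefB eq_pq subrr; by [].
Qed.

(** One generator is adjoined. Let [Y] in [S[Y]] map to [r] in [R], over
    [e : S -> R]. A morphism [phi] from [S] that respects the kernel of [e]
    extends to [S[Y]] by choosing the image [xi] of [Y], and the extension
    respects the kernel of evaluation at [r] as soon as [xi] is a root of the
    image of a suitable polynomial [g] and [phi] does not kill a suitable [u].
    If [r] is algebraic, [g] is its minimal polynomial; if [r] is
    transcendental, there is nothing to respect, and [g] is [Y v - 1] so that
    its roots are not roots of [v]. In both cases [v], which may be thought of
    as a denominator, is kept nonzero. *)
Lemma extension_step (S R : idomainType) (e : {rmorphism S -> R}) (r : R)
    (v : {poly S}) : (map_poly e v).[r] != 0 ->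
  exists (u : S) (g : {poly S}), e u != 0 /\
    forall (L : fieldType) (phi : {rmorphism S -> L}),
      (forall s, e s = 0 -> phi s = 0) -> phi u != 0 ->
      size (map_poly phi g) != 1 /\
      forall xi, root (map_poly phi g) xi ->
        (map_poly phi v).[xi] != 0 /\
        forall q, (map_poly e q).[r] = 0 -> (map_poly phi q).[xi] = 0.
Proof.
move=> nz_v.
pose P (q : {poly S}) := (map_poly e q).[r] = 0.
have [alg|trans] := classic (exists q, P q /\ map_poly e q != 0); last first.
  pose i := (size (map_poly e v)).-1.
  have nz_ev : map_poly e v != 0 by apply: contraNneq nz_v => ->; rewrite horner0.
  (* [v`_i] is the leading coefficient of the image of [v] *)
  exists v`_i, ('X * v - 1); split.
    by rewrite -coef_map -lead_coefE lead_coef_eq0.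
  move=> L phi kphi nz_u; rewrite rmorphB rmorphM rmorph1 /= map_polyX.
  have nz_pv : map_poly phi v != 0.
    by apply: contraNneq nz_u => pv0; rewrite -coef_map pv0 coef0.
  split.
    apply/negP=> /size_poly1P[c _ /eqP]; rewrite subr_eq => /eqP Xv.
    have := size_polyC (c + 1); rewrite polyCD polyC1 -Xv mulrC size_mulX //.
    by move: nz_pv; rewrite -size_poly_gt0; case: (size _) => // k _; case: eqP.
  move=> xi /rootP; rewrite !hornerE => /eqP; rewrite subr_eq0 => /eqP xv; split.
    apply: contra_eqN xv => /eqP->; by rewrite mulr0 eq_sym oner_eq0.
  move=> q Pq; rewrite (map_poly_kernel (q := 0) kphi) ?rmorph0 ?horner0 //.
  by apply/eqP/negPn/negP=> nz_q; apply: trans; exists q.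
have evB c h p q : (map_poly e (c *: p - h * q)).[r] =
    e c * (map_poly e p).[r] - (map_poly e h).[r] * (map_poly e q).[r].
  by rewrite rmorphB rmorphM /= map_polyZ !hornerE.
have [|p q eq_pq|//|q [Pq lead_q gen_q]] := minimal_generator (e := e) (P := P).
- by move=> c h p q Pp Pq; rewrite /P evB Pp Pq !mulr0 subr0.
- by rewrite /P eq_pq.
(* the ideal generated by [v] and the kernel [P]; it contains a constant
   outside the kernel of [e], because [P] is prime and [q] minimal *)
pose J (g : {poly S}) := exists w,
  (map_poly e g).[r] = (map_poly e w).[r] * (map_poly e v).[r].
have Jv : J v by exists 1; rewrite rmorph1 hornerC mul1r.
have Jq : J q by exists 0; rewrite rmorph0 horner0 mul0r.
have [|p1 p2 eq_p||g [[w Dg] lead_g gen_g]] := minimal_generator (e := e) (P := J).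
- move=> c h p1 p2 [w1 D1] [w2 D2]; exists (c *: w1 - h * w2).
  by rewrite !evB D1 D2 mulrBl !mulrA.
- by rewrite /J eq_p.
- by exists q; split=> //; rewrite -lead_coef_eq0 lead_coef_map_eq.
have [N [h Dh]] := gen_g q Jq.
have [N' [h' Dh']] := gen_g v Jv.
have ev_eq p1 p2 : map_poly e p1 = map_poly e p2 ->
  (map_poly e p1).[r] = (map_poly e p2).[r] by move=> ->.
have nz_g : (map_poly e g).[r] != 0.
  have := ev_eq _ _ Dh'; rewrite rmorphM /= map_polyZ !hornerE => Dg'.
  apply: contraNneq nz_v => g0; move/eqP: Dg'.
  by rewrite g0 mulr0 mulf_eq0 rmorphXn expf_eq0 (negPf lead_g) andbF.
have Ph : P h.
  have := ev_eq _ _ Dh; rewrite rmorphM /= map_polyZ !hornerE Pq mulr0 => /esym/eqP.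
  by rewrite mulf_eq0 (negPf nz_g) orbF => /eqP.
have lead_neq0 (a : S) k : e a != 0 -> e (a ^+ k) != 0.
  by move=> nz_a; rewrite rmorphXn expf_neq0.
have nz_q : map_poly e q != 0 by rewrite -lead_coef_eq0 lead_coef_map_eq.
have g_const : size g = 1.
  have nz_hg : map_poly e h * map_poly e g != 0.
    have <- : map_poly e (h * g) = map_poly e h * map_poly e g by rewrite rmorphM.
    rewrite -Dh map_polyZ -mul_polyC mulf_eq0 polyC_eq0 negb_or nz_q andbT.
    exact: lead_neq0.
  have [nz_h nz_g'] := norP (etrans (esym (congr1 negb (mulf_eq0 _ _))) nz_hg).
  have [N1 [h1 Dh1]] := gen_q h Ph.
  have := congr1 (fun p : {poly R} => size p) Dh1.
  rewrite rmorphM /= map_polyZ size_scale ?lead_neq0 // => size_h.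
  have nz_h1 : map_poly e h1 != 0.
    apply: contraNneq nz_h => h10.
    by rewrite -size_poly_eq0 size_h h10 mul0r size_poly0.
  have := congr1 (fun p : {poly R} => size p) Dh.
  rewrite rmorphM /= map_polyZ size_scale ?lead_neq0 // !size_mul //.
  rewrite size_mul // in size_h.
  rewrite -(map_lead_neq0_size lead_g).
  have arith (a b c d : nat) : (0 < a)%N -> (0 < b)%N -> (0 < c)%N -> (0 < d)%N ->
    b = (d + a).-1 -> a = (b + c).-1 -> c = 1 by lia.
  move: size_h; apply: arith; by rewrite size_poly_gt0.
have [c nz_c Dc] : exists2 c, e c != 0 & g = c%:P.
  move/eqP/size_poly1P: g_const => [c _ Dc]; exists c => //.
  by move: lead_g; rewrite Dc lead_coefC.
exists (lead_coef q * c), q; split; first by rewrite rmorphM mulf_neq0.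
move=> L phi kphi; rewrite rmorphM mulf_eq0 negb_or => /andP[nz_lq nz_pc].
split.
  rewrite map_lead_neq0_size //; apply: contraNneq lead_q => /eqP/size_poly1P[a _ Da].
  by rewrite Da lead_coefC; move: Pq; rewrite /P Da map_polyC hornerC /= => ->.
move=> xi /rootP q_xi.
have Pphi p : P p -> (map_poly phi p).[xi] = 0.
  move=> Pp; have [k [a Da]] := gen_q p Pp.
  have /(congr1 (horner^~ xi)) := map_poly_kernel kphi Da.
  rewrite rmorphM /= map_polyZ !hornerE q_xi mulr0 => /eqP.
  by rewrite mulf_eq0 rmorphXn expf_eq0 (negPf nz_lq) andbF => /eqP.
split=> //; have : P (c%:P - w * v).
  by rewrite /P rmorphB rmorphM /= !hornerE -Dg -Dc subrr.
move/Pphi; rewrite rmorphB rmorphM /= map_polyC !hornerE => /eqP.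
rewrite subr_eq0 => /eqP Dpc; apply: contraNneq nz_pc => v0.
by rewrite Dpc v0 mulr0.
Qed.

(** * Extension of specialisations *)

(** The extension of a specialisation is needed in two situations: with values
    in an algebraically closed field, and with values in a field that may be
    enlarged at will. The class [Q] of admissible fields over [F] covers both.
    It depends on the plain function underlying [k] so that reassociating a
    composition is a conversion. *)
Definition adjoins_roots (F : fieldType)
    (Q : forall L : fieldType, (F -> L) -> Prop) : Prop :=
  forall (L : fieldType) (k : {rmorphism F -> L}), Q L k ->
  forall g : {poly L}, size g != 1 ->
  exists (L' : fieldType) (tau : {rmorphism L -> L'}) (xi : L'),
    Q L' (tau \o k) /\ root (map_poly tau g) xi.

(** The ring [T] is an iterated polynomial ring over [S], rather than a subring
    of [R]: a morphism from it is free to choose the images of the variables,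
    and only the kernel of [E] has to be respected. *)
Lemma extension_tower (F : fieldType)
    (Q : forall L : fieldType, (F -> L) -> Prop) (R : idomainType)
    (rs : seq R) (S : idomainType) (e : {rmorphism S -> R}) :
    adjoins_roots Q ->
  exists (T : idomainType) (i : {rmorphism S -> T}) (E : {rmorphism T -> R}),
  [/\ forall s, E (i s) = e s,
      forall r, r \in rs -> exists t, E t = r
    & forall v, E v != 0 -> exists u, e u != 0 /\
      forall (L : fieldType) (k : {rmorphism F -> L}) (phi : {rmorphism S -> L}),
        Q L k -> (forall s, e s = 0 -> phi s = 0) -> phi u != 0 ->
      exists (L' : fieldType) (tau : {rmorphism L -> L'})
             (psi : {rmorphism T -> L'}),
        [/\ Q L' (tau \o k), forall s, psi (i s) = tau (phi s),
            forall t, E t = 0 -> psi t = 0 & psi v != 0]].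
Proof.
move=> Qroot; elim: rs S e => [|r rs IHrs] S e.
  exists S, idfun, e; split=> // v nz_v; exists v; split=> // L k phi Qk kphi nz_u.
  have [|L' [tau [_ [Qt _]]]] := Qroot L k Qk 0; first by rewrite size_poly0.
  exists L', tau, (tau \o phi); split=> //= [t /kphi->|]; first by rewrite rmorph0.
  by rewrite fmorph_eq0.
pose er : {rmorphism {poly S} -> R} := horner_eval r \o map_poly e.
have erE q : er q = (map_poly e q).[r] by [].
have [T [i [E [Ei Ers Eext]]]] := IHrs {poly S} er.
exists T, (i \o polyC), E; split=> [s|r'|v nz_v] /=.
- by rewrite Ei erE map_polyC hornerC.
- rewrite inE => /predU1P[->|/Ers//]; exists (i 'X).
  by rewrite Ei erE map_polyX hornerX.
have [w [nz_w w_ext]] := Eext v nz_v.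
have [u [g [nz_u g_ext]]] := extension_step nz_w.
exists u; split=> // L k phi Qk kphi nz_pu.
have [sz_g _] := g_ext L phi kphi nz_pu.
have [L1 [tau1 [xi [Q1]]]] := Qroot L k Qk _ sz_g.
rewrite -map_poly_comp => g_xi.
have kphi1 s : e s = 0 -> (tau1 \o phi) s = 0 by move=> /= /kphi->; rewrite rmorph0.
have [|_ /(_ xi g_xi)[nz_w1 kw]] := g_ext L1 (tau1 \o phi) kphi1.
  by rewrite fmorph_eq0.
pose phi1 : {rmorphism {poly S} -> L1} := horner_eval xi \o map_poly (tau1 \o phi).
have [L2 [tau2 [psi [Q2 psi_i psi_ker psi_v]]]] := w_ext L1 (tau1 \o k) phi1 Q1 kw nz_w1.
exists L2, (tau2 \o tau1), psi; split=> // s.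
by rewrite /= psi_i /phi1 /= map_polyC /horner_eval hornerC.
Qed.

Lemma mpoly_rmorph_ext (F : fieldType) (n : nat) (S : comNzRingType)
    (f g : {rmorphism {mpoly F[n]} -> S}) :
  (forall c, f c%:MP = g c%:MP) -> (forall i, f 'X_i = g 'X_i) -> f =1 g.
Proof.
move=> eqC eqX p; rewrite [p]mpolyE !rmorph_sum; apply: eq_bigr => m _.
rewrite -mul_mpolyC !rmorphM eqC mpolyXE_id !rmorph_prod; congr (_ * _).
by apply: eq_bigr => i _; rewrite !rmorphXn eqX.
Qed.

(** The morphisms [e : S -> R] and [pi : F[X_1, ..., X_n] -> R] present two
    subalgebras of [R]. A general specialisation [phi] of the first extends to
    the second, where one may moreover require [v] not to vanish. *)
Lemma extension_theorem (F : fieldType)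
    (Q : forall L : fieldType, (F -> L) -> Prop) (n : nat)
    (R S : idomainType) (pi : {rmorphism {mpoly F[n]} -> R})
    (k0 : {rmorphism F -> S}) (e : {rmorphism S -> R}) (v : {mpoly F[n]}) :
    adjoins_roots Q -> (forall c, e (k0 c) = pi c%:MP) -> pi v != 0 ->
  exists u, e u != 0 /\ forall (L : fieldType) (phi : {rmorphism S -> L}),
    Q L (phi \o k0) -> (forall s, e s = 0 -> phi s = 0) -> phi u != 0 ->
  exists (L' : fieldType) (tau : {rmorphism L -> L'})
         (chi : {rmorphism {mpoly F[n]} -> L'}),
    [/\ Q L' (tau \o (phi \o k0)), chi v != 0,
        forall f, pi f = 0 -> chi f = 0
      & forall s f, e s = pi f -> tau (phi s) = chi f].
Proof.
move=> Qroot e_k0 nz_v.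
have [T [i [E [Ei Ers Eext]]]] :=
  extension_tower [seq pi 'X_j | j <- enum 'I_n] e Qroot.
have Xlift j : exists t, E t = pi 'X_j.
  by apply: Ers; apply/mapP; exists j; rewrite ?mem_enum.
pose t j := epsilon (inhabits 0) (fun t => E t = pi 'X_j).
have Et j : E (t j) = pi 'X_j by exact: (epsilon_spec _ _ (Xlift j)).
pose rho : {rmorphism {mpoly F[n]} -> T} := mmap (i \o k0) t.
have E_rho f : E (rho f) = pi f.
  apply: (@mpoly_rmorph_ext F n R (E \o rho) pi) => [c|j] /=.
    by rewrite mmapC /= Ei.
  by rewrite mmapX mmap1U.
have [u [nz_u u_ext]] := Eext (rho v) (etrans (congr1 (fun x => x != 0) (E_rho v)) nz_v).
exists u; split=> // L phi Qphi kphi nz_pu.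
have [L' [tau [psi [Q' psi_i psi_ker psi_v]]]] := u_ext L _ phi Qphi kphi nz_pu.
exists L', tau, (psi \o rho); split=> //= [f f0|s f Df].
  by rewrite psi_ker // E_rho.
apply/eqP; rewrite -psi_i -subr_eq0 -rmorphB psi_ker //.
by rewrite rmorphB Ei E_rho Df subrr.
Qed.

(** * Nullstellensatz and values of nonconstant functions *)

Lemma irreducible_factor (L : fieldType) (g : {poly L}) : (1 < size g)%N ->
  exists2 h, irreducible_poly h & h %| g.
Proof.
move=> g_gt1; pose P (h : {poly L}) := h %| g /\ (1 < size h)%N.
have [|h [[h_g h_gt1] min_h]] := exists_minimal (fun h : {poly L} => size h) (P := P).
  by exists g; split; rewrite ?dvdpp.
exists h => //; split=> // q sz_q q_h; rewrite -dvdp_size_eqp // eqn_leq.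
have nz_h : h != 0 by rewrite -size_poly_gt0 ltnW.
rewrite dvdp_leq //= min_h //; split; first exact: dvdp_trans h_g.
rewrite ltn_neqAle eq_sym sz_q size_poly_gt0.
by apply: contraNneq nz_h => q0; rewrite q0 dvd0p in q_h.
Qed.

Lemma adjoins_roots_any (F : fieldType) :
  adjoins_roots (fun (L : fieldType) (_ : F -> L) => True).
Proof.
move=> L k _ g sz_g; have [->|nz_g] := eqVneq g 0.
  by exists L, idfun, 0; rewrite rmorph0 root0.
have [|h irr_h /dvdpP[q ->]] := @irreducible_factor L g.
  by rewrite ltn_neqAle eq_sym sz_g size_poly_gt0.
have [L' _ [z hz _]] := irredp_FAdjoin irr_h.
by exists L', (in_alg L'), z; split=> //; rewrite rmorphM rootM hz orbT.
Qed.

(** Over a closed field one keeps a retraction [sigma] onto [F], through which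
    every root is found in [F] itself. *)
Lemma adjoins_roots_closed (F : closedFieldType) :
  adjoins_roots (fun (L : fieldType) (k : F -> L) =>
    exists sigma : {rmorphism L -> F}, forall c, sigma (k c) = c).
Proof.
move=> L k [sigma sigmaK] g sz_g.
have /closed_rootP[xi g_xi] : size (map_poly sigma g) != 1 by rewrite size_map_poly.
by exists F, sigma, xi; split=> //; exists idfun.
Qed.

Lemma descend_rmorph (P R L : nzRingType) (pi : {rmorphism P -> R})
    (h : {rmorphism P -> L}) :
    (forall a, exists f, pi f = a) -> (forall f, pi f = 0 -> h f = 0) ->
  exists x : {rmorphism R -> L}, forall f, x (pi f) = h f.
Proof.
move=> pi_surj ker_h.
pose lift a := epsilon (inhabits 0) (fun f => pi f = a).
have liftK a : pi (lift a) = a by exact: (epsilon_spec _ _ (pi_surj a)).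
pose x0 := h \o lift.
have x0E f : x0 (pi f) = h f.
  apply/eqP; rewrite -subr_eq0 -rmorphB ker_h //.
  by rewrite rmorphB liftK subrr.
have x0B : zmod_morphism x0.
  by move=> a b; rewrite -[a]liftK -[b]liftK -rmorphB !x0E rmorphB.
have x0M : monoid_morphism x0.
  split; first by rewrite -(rmorph1 pi) x0E rmorph1.
  by move=> a b; rewrite -[a]liftK -[b]liftK -rmorphM !x0E rmorphM.
pose x : {rmorphism R -> L} := HB.pack x0 (GRing.isZmodMorphism.Build _ _ x0 x0B)
  (GRing.isMonoidMorphism.Build _ _ x0 x0M).
by exists x.
Qed.

Lemma mpoly_rmorph_meval (F : fieldType) (n : nat)
    (x : {rmorphism {mpoly F[n]} -> F}) :
  (forall c, x c%:MP = c) -> forall f, x f = f.@[[ffun i => x 'X_i]].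
Proof.
move=> xC; apply: (@mpoly_rmorph_ext F n F x (meval [ffun i => x 'X_i])) => [c|i].
  by rewrite xC; symmetry; apply: mevalC.
by symmetry; apply: etrans (mevalXU _ _) _; rewrite ffunE.
Qed.

Section ClosedField.
Variable F : closedFieldType.

(** The prime ideal is given as the kernel of [pi]; the point comes from
    extending the identity of [F]. *)
Theorem nullstellensatz (n : nat) (R : idomainType)
    (pi : {rmorphism {mpoly F[n]} -> R}) (v : {mpoly F[n]}) : pi v != 0 ->
  exists x : {ffun 'I_n -> F}, (forall f, pi f = 0 -> f.@[x] = 0) /\ v.@[x] != 0.
Proof.
move=> nz_v.
have [u [nz_u]] := @extension_theorem F _ n R F pi idfun (pi \o mpolyC n (R:=F)) v
  (@adjoins_roots_closed F) (fun c => erefl) nz_v.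
case/(_ F idfun) => [|s /eqP||L' [tau [chi [[sigma sigmaK] nz_chi chi_ker chiE]]]].
- by exists idfun.
- by rewrite fmorph_eq0 => /eqP.
- by apply: contraNneq nz_u => /= ->; rewrite rmorph0.
pose x : {rmorphism {mpoly F[n]} -> F} := sigma \o chi.
have xC c : x c%:MP = c by rewrite /= -(chiE c) // [RHS](esym (sigmaK c)).
exists [ffun i => x 'X_i]; split=> [f f0|]; rewrite -mpoly_rmorph_meval //.
  by rewrite /= chi_ker ?rmorph0.
by rewrite /= fmorph_eq0.
Qed.

(** A polynomial over the closed field [F] splits, so an element of a domain
    that is algebraic over [F] lies in [F]. *)
Lemma nonconstant_transcendental (R : idomainType) (iota : {rmorphism F -> R}) (a : R)
    (q : {poly F}) :
  ~ (exists c, a = iota c) -> (map_poly iota q).[a] = 0 -> q = 0.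
Proof.
move=> a_nc; have [r ->] := closed_field_poly_normal q.
rewrite map_polyZ rmorph_prod hornerZ horner_prod => /eqP.
rewrite mulf_eq0 fmorph_eq0 => /orP[/eqP->|]; first by rewrite scale0r.
rewrite prodf_seq_eq0 => /hasP[c _].
rewrite rmorphB /= map_polyX map_polyC !hornerE subr_eq0 => /eqP Da.
by case: a_nc; exists c.
Qed.

(** A nonconstant function takes almost every value: the specialisations
    [X |-> alpha] of [F[X]], which is [F[a]], extend to [R] outside the roots
    of [u]. *)
Lemma nonconstant_dominant (n : nat) (R : idomainType) (iota : {rmorphism F -> R})
    (pi : {rmorphism {mpoly F[n]} -> R}) (a : R) :
    (forall c, pi c%:MP = iota c) -> (forall b, exists f, pi f = b) ->
    ~ (exists c, a = iota c) ->
  exists u : {poly F}, u != 0 /\ forall alpha, u.[alpha] != 0 ->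
    exists x : {rmorphism R -> F}, (forall c, x (iota c) = c) /\ x a = alpha.
Proof.
move=> piC pi_surj a_nc.
pose e : {rmorphism {poly F} -> R} := horner_eval a \o map_poly iota.
have eE q : e q = (map_poly iota q).[a] by [].
have e_C c : e c%:P = pi c%:MP by rewrite eE map_polyC hornerC piC.
have nz_1 : pi 1 != 0 by rewrite rmorph1 oner_eq0.
have [u [nz_u u_ext]] := @extension_theorem F _ n R _ pi polyC e 1
  (@adjoins_roots_closed F) e_C nz_1.
exists u; split=> [|alpha nz_ua]; first by apply: contraNneq nz_u => ->; rewrite rmorph0.
have := u_ext F (horner_eval alpha).
case=> [|s /(nonconstant_transcendental a_nc)->||L' [tau [chi]]].
- by exists idfun => c; rewrite /= /horner_eval hornerC.
- by rewrite rmorph0.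
- by [].
case=> [[sigma sigmaK] _ chi_ker chiE].
have [x xE] : exists x : {rmorphism R -> F}, forall f, x (pi f) = (sigma \o chi) f.
  by apply: descend_rmorph => // f /= /chi_ker->; rewrite rmorph0.
exists x; split=> [c|].
  by rewrite -piC xE /= -(chiE c%:P) //; apply: sigmaK.
have [fa Da] := pi_surj a.
rewrite -Da xE /= -(chiE 'X); last by rewrite eE map_polyX hornerX Da.
apply: etrans (sigmaK alpha); rewrite /=; do 2!congr (GRing.RMorphism.sort _ _).
by apply: etrans (hornerX _) (esym (hornerC _ _)).
Qed.

End ClosedField.

(** * Curves have transcendence degree one *)

Section Dimension.
Variables (F : closedFieldType) (n : nat).

(** Exchanging the variables reduces this to one variable, where [F] is
    infinite. *)
Lemma specialise_nonzero (u : {poly {poly F}}) : u != 0 ->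
  exists alpha : F, u.[alpha%:P] != 0.
Proof.
rewrite -swapXY_eq0 => nz_w.
set w := swapXY u in nz_w.
have /closed_nonrootP[alpha nz_a] : lead_coef w != 0 by rewrite lead_coef_eq0.
exists alpha; apply: contraNneq nz_a => ua; apply/rootP.
have := congr1 (fun q : {poly F} => q`_(size w).-1) ua.
by rewrite -[u]swapXYK horner_swapXY coef_map coef0.
Qed.

Lemma point_closed (x0 : {ffun 'I_n -> F}) : zariski_closed (fun x => x = x0).
Proof.
exists (fun f => f.@[x0] = 0) => x; split=> [-> //|x0x].
apply/ffunP=> i; apply/eqP; rewrite -subr_eq0.
by have := x0x ('X_i - (x0 i)%:MP); rewrite !mevalB !mevalXU !mevalC subrr => ->.
Qed.

Lemma point_irreducible (x0 : {ffun 'I_n -> F}) : zariski_irreducible (fun x => x = x0).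
Proof.
split; first by exists x0.
move=> C1 C2 _ _ /(_ x0 erefl)[C1x|C2x]; [left|right] => x ->; by [].
Qed.

Definition zero_locus (R : idomainType) (chi : {mpoly F[n]} -> R)
    (x : {ffun 'I_n -> F}) : Prop :=
  forall f, chi f = 0 -> f.@[x] = 0.

Lemma zero_locus_closed (R : idomainType) (chi : {mpoly F[n]} -> R) :
  zariski_closed (zero_locus chi).
Proof. by exists (fun f => chi f = 0). Qed.

(** The ideal of the zero locus of a prime ideal is that ideal. *)
Lemma vanishing_on_zero_locus (R : idomainType) (chi : {rmorphism {mpoly F[n]} -> R}) f :
  (forall x, zero_locus chi x -> f.@[x] = 0) -> chi f = 0.
Proof.
move=> f0; apply/eqP; apply: contraT => /nullstellensatz[x [/f0->]].
by rewrite eqxx.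
Qed.

Lemma zero_locus_irreducible (R : idomainType) (chi : {rmorphism {mpoly F[n]} -> R}) :
  zariski_irreducible (zero_locus chi).
Proof.
split.
  have [|x [x0 _]] := @nullstellensatz F n R chi 1; first by rewrite rmorph1 oner_eq0.
  by exists x.
move=> C1 C2 [S1 DC1] [S2 DC2] cover.
have [sub1|nsub1] := classic (forall f, S1 f -> chi f = 0).
  by left=> x Zx; apply/DC1 => f /sub1; apply: Zx.
have [sub2|nsub2] := classic (forall f, S2 f -> chi f = 0).
  by right=> x Zx; apply/DC2 => f /sub2; apply: Zx.
have [f1 [S1f1 nz_f1]] : exists f, S1 f /\ chi f != 0.
  apply: NNPP => no_f; apply: nsub1 => f S_f; apply: NNPP => /eqP nz_f.
  by apply: no_f; exists f.
have [f2 [S2f2 nz_f2]] : exists f, S2 f /\ chi f != 0.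
  apply: NNPP => no_f; apply: nsub2 => f S_f; apply: NNPP => /eqP nz_f.
  by apply: no_f; exists f.
have [|x [/cover Cx]] := @nullstellensatz F n R chi (f1 * f2).
  by rewrite rmorphM mulf_neq0.
rewrite mevalM mulf_eq0; case: Cx => [/DC1/(_ _ S1f1)->|/DC2/(_ _ S2f2)->].
  by rewrite eqxx.
by rewrite eqxx orbT.
Qed.

(** If [a] and [b] were independent, [a |-> alpha, b |-> 'X] would extend for
    some [alpha] to a specialisation [chi] of [R] in an extension of [F('X)].
    The zero locus of its kernel is irreducible; it is not the curve since [a]
    is not constant, and not a point since ['X] is not constant. *)
Lemma curve_algebraic_relation (C : {ffun 'I_n -> F} -> Prop) (R : idomainType)
    (iota : {rmorphism F -> R}) (a b : R) :
    zariski_closed C -> zariski_irreducible C -> ~ has_irreducible_chain C 2 ->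
    is_coordinate_ring iota C -> ~ (exists c, a = iota c) ->
  exists2 f : {poly {poly F}}, f != 0 &
    (map_poly (horner_eval b \o map_poly iota) f).[a] = 0.
Proof.
move=> [S_C DC] C_irr no_chain [pi [piC pi_surj pi_ker]] a_nc.
apply: NNPP => no_rel; apply: no_chain.
pose e : {rmorphism {poly {poly F}} -> R} :=
  horner_eval a \o map_poly (horner_eval b \o map_poly iota).
have eE q : e q = (map_poly (horner_eval b \o map_poly iota) q).[a] by [].
have e_inj q : e q = 0 -> q = 0.
  by move=> q0; apply: NNPP => /eqP nz_q; apply: no_rel; exists q.
have e_C c : e (polyC (polyC c)) = pi c%:MP.
  by rewrite eE map_polyC hornerC /= map_polyC /horner_eval hornerC piC.
have nz_1 : pi 1 != 0 by rewrite rmorph1 oner_eq0.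
have [u [nz_u]] := @extension_theorem F _ n R _ pi (polyC \o polyC) e 1
  (@adjoins_roots_any F) e_C nz_1.
have [|alpha nz_ua] := @specialise_nonzero u.
  by apply: contraNneq nz_u => ->; rewrite rmorph0.
pose phi : {rmorphism {poly {poly F}} -> {fraction {poly F}}} :=
  @tofrac {poly F} \o horner_eval alpha%:P.
have phiE q : phi q = tofrac q.[alpha%:P] by [].
case/(_ _ phi I) => [s /e_inj->||L [tau [chi [_ _ chi_ker chiE]]]].
- by rewrite rmorph0.
- by rewrite phiE tofrac_eq0.
have [fa Dfa] := pi_surj a; have [fb Dfb] := pi_surj b.
have chiC c : chi c%:MP = tau (tofrac c%:P).
  by rewrite -(chiE _ _ (e_C c)) phiE hornerC.
have chi_a : chi fa = tau (tofrac alpha%:P).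
  by rewrite -(chiE 'X) ?phiE ?hornerX // eE map_polyX hornerX.
have chi_b : chi fb = tau (tofrac 'X).
  rewrite -(chiE 'X%:P) ?phiE ?hornerC // eE map_polyC hornerC /=.
  by rewrite map_polyX /horner_eval hornerX.
have [x0 Zx0] := (zero_locus_irreducible chi).1.
have ZC x : zero_locus chi x -> C x.
  move=> Zx; apply/DC => f S_f; apply/Zx/chi_ker/pi_ker => y /DC; exact.
exists (fun i => match i with 0 => fun x => x = x0 | 1 => zero_locus chi | _ => C end).
split=> [[|[|i]] _|[|[|i]] //= _].
- by split; [exact: point_closed | exact: point_irreducible | move=> x ->; apply: ZC].
- by split; [exact: zero_locus_closed | exact: zero_locus_irreducible | ].
- by split; first exists S_C.
- split=> [x ->//|]; apply: NNPP => Zpt.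
  have : chi (fb - (fb.@[x0])%:MP) = 0.
    apply: vanishing_on_zero_locus => x Zx; rewrite mevalB mevalC.
    suff -> : x = x0 by rewrite subrr.
    by apply: NNPP => x_x0; apply: Zpt; exists x.
  rewrite rmorphB chi_b chiC -!rmorphB => /eqP; rewrite fmorph_eq0 /= tofrac_eq0.
  by rewrite polyXsubC_eq0.
split=> //; apply: NNPP => CZ; apply: a_nc; exists alpha.
apply/eqP; rewrite -Dfa -piC -subr_eq0 -rmorphB; apply/eqP/pi_ker => x Cx.
have Zx : zero_locus chi x by apply: NNPP => nZx; apply: CZ; exists x.
by apply: Zx; rewrite rmorphB chi_a chiC subrr.
Qed.

End Dimension.

(** * Multiplicative order modulo powers of an odd prime *)

Section OrderGrowth.
Local Open Scope nat_scope.

Lemma geometric_sum_mod l y N : y = 1 %[mod l] -> \sum_(i < N) y ^ i = N %[mod l].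
Proof.
move=> y1; rewrite -modn_summ (eq_bigr (fun=> 1 %% l)).
  by rewrite modn_summ sum1_card card_ord.
by move=> i _; rewrite -modnXm y1 modnXm exp1n.
Qed.

Lemma expn_mod_square l m i : (1 + l * m) ^ i = 1 + i * (l * m) %[mod l ^ 2].
Proof.
elim: i => [|i IHi] //; rewrite expnS -modnMmr IHi modnMmr.
have -> : (1 + l * m) * (1 + i * (l * m)) = i * m * m * l ^ 2 + (1 + i.+1 * (l * m)).
  by rewrite mulSn; nia.
by rewrite modnMDl.
Qed.

(** Modulo [l ^ 2] the sum is [l + l m l (l - 1) / 2] for [y = 1 + l m]; as [l]
    is odd, it divides [l (l - 1) / 2]. *)
Lemma geometric_sum_prime l y : prime l -> odd l -> 0 < y -> y = 1 %[mod l] ->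
  logn l (\sum_(i < l) y ^ i) = 1.
Proof.
move=> l_pr l_odd y_gt0 y1; have l_gt1 := prime_gt1 l_pr.
have [m Dy] : exists m, y = 1 + l * m.
  exists (y %/ l); rewrite {1}(divn_eq y l) y1 modn_small // addnC mulnC //.
have sum_l : \sum_(i < l) y ^ i = l %[mod l ^ 2].
  rewrite -modn_summ (eq_bigr (fun i : 'I_l => (1 + i * (l * m)) %% l ^ 2)).
    rewrite modn_summ big_split /= sum1_card card_ord -big_distrl /=.
    rewrite -(big_mkord xpredT id) /= bin2_sum.
    have /dvdnP[t ->] : l %| 'C(l, 2).
      by rewrite prime_dvd_bin //= ltn_neqAle l_gt1 andbT; case: eqP l_odd => // <-.
    by rewrite addnC (_ : t * l * (l * m) = t * m * l ^ 2) ?modnMDl //; nia.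
  by move=> i _; rewrite Dy expn_mod_square.
have l_lt : l < l ^ 2 by rewrite -{1}[l]expn1 ltn_exp2l.
have S_gt0 : 0 < \sum_(i < l) y ^ i.
  by rewrite lt0n; apply: contra_eq_neq sum_l => ->; rewrite mod0n modn_small; lia.
apply/eqP; rewrite eqn_leq -pfactor_dvdn // andbC.
rewrite expn1 /dvdn -(@modn_dvdm (l ^ 2)) ?dvdn_exp // sum_l modn_dvdm ?dvdn_exp // modnn /=.
rewrite leqNgt -pfactor_dvdn // /dvdn sum_l modn_small //; lia.
Qed.

Lemma logn_expn_sub1 l Q t : prime l -> odd l -> 1 < Q -> Q = 1 %[mod l] ->
  logn l (Q ^ (l ^ t)).-1 = logn l Q.-1 + t.
Proof.
move=> l_pr l_odd Q_gt1 Q1; elim: t => [|t IHt]; first by rewrite expn1 addn0.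
have Qt_gt1 : 1 < Q ^ (l ^ t).
  by rewrite -(exp1n (l ^ t)) ltn_exp2r // expn_gt0 prime_gt0.
rewrite expnSr expnM predn_exp lognM; last 2 first.
- by rewrite -ltnS prednK // ltnW.
- rewrite (bigD1 (Ordinal (prime_gt0 l_pr))) //=.
rewrite IHt geometric_sum_prime ?addnA ?addnS ?addn0 //; first exact: ltnW.
by rewrite -modnXm Q1 modnXm exp1n.
Qed.

(** The order of [Q] modulo [l ^ (c + k)] is at least [l ^ k], with [c] the
    valuation of [Q - 1], since the valuation of [Q ^ N - 1] is [c] plus that
    of [N]. *)
Lemma order_growth l Q k i j : prime l -> odd l -> 1 < Q -> Q = 1 %[mod l] ->
  i < l ^ k -> j < l ^ k -> Q ^ i = Q ^ j %[mod l ^ (logn l Q.-1 + k)] -> i = j.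
Proof.
move=> l_pr l_odd Q_gt1 Q1; wlog le_ij : i j / i <= j.
  by move=> IH ltik ltjk Qij; have [/IH->|/ltnW/IH<-] := leqP i j.
move=> _ lt_jk Qij; apply/eqP; rewrite eqn_leq le_ij /=; apply: contraT.
rewrite -ltnNge -subn_gt0 => N_gt0; set N := j - i in N_gt0.
have Qg0 a : 0 < Q ^ a by rewrite expn_gt0 ltnW.
have dvdN : l ^ (logn l Q.-1 + k) %| (Q ^ N).-1.
  have co : coprime (l ^ (logn l Q.-1 + k)) (Q ^ i).
    rewrite coprimeXl // coprimeXr // prime_coprime //.
    by rewrite /dvdn Q1 modn_small // prime_gt1.
  rewrite -(Gauss_dvdr _ co) -(subn1 (Q ^ N)) mulnC mulnBl mul1n -expnD /N subnK //.
  by rewrite -eqn_mod_dvd ?leq_exp2l // Qij.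
have [N' coN' DN] := pfactor_coprime l_pr N_gt0; set t := logn l N in DN.
have N'_gt0 : 0 < N' by move: N_gt0; rewrite DN muln_gt0 => /andP[].
have t_lt : t < k.
  rewrite -(@ltn_exp2l l) ?prime_gt1 //; apply: leq_ltn_trans _ lt_jk.
  by apply: leq_trans (leq_subr i j); rewrite -/N DN leq_pmull.
have Qt_gt1 : 1 < Q ^ (l ^ t).
  by rewrite -(exp1n (l ^ t)) ltn_exp2r // expn_gt0 prime_gt0.
have Qt1 : Q ^ (l ^ t) = 1 %[mod l] by rewrite -modnXm Q1 modnXm exp1n.
have logS : logn l (\sum_(i < N') (Q ^ (l ^ t)) ^ i) = 0.
  apply/eqP; rewrite logn_coprime //.
  by rewrite /coprime -gcdn_modr geometric_sum_mod // gcdn_modr.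
have logN : logn l (Q ^ N).-1 = logn l Q.-1 + t.
  rewrite DN mulnC expnM predn_exp lognM ?logS ?addn0 ?logn_expn_sub1 //.
    by rewrite -ltnS prednK // ltnW.
  by rewrite (bigD1 (Ordinal N'_gt0)).
have QN_gt0 : 0 < (Q ^ N).-1.
  rewrite -ltnS prednK //; rewrite -(exp1n N) ltn_exp2r //.
by move: dvdN; rewrite pfactor_dvdn // logN leq_add2l leqNgt t_lt.
Qed.
End OrderGrowth.

(** * Frobenius and roots of unity *)

Lemma frobenius_power (K : comNzRingType) p r : p \in [pchar K] ->
  exists tau : {rmorphism K -> K}, forall x, tau x = x ^+ (p ^ r).
Proof.
move=> pK; elim: r => [|r [tau tauE]]; first by exists idfun => x; rewrite expr1.
exists (pFrobenius_aut pK \o tau) => x /=.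
by rewrite pFrobenius_autE tauE -exprM expnSr.
Qed.

Lemma frobenius_inj (K : fieldType) p r : p \in [pchar K] ->
  injective (fun x : K => x ^+ (p ^ r)).
Proof.
move=> pK x y; have [tau tauE] := frobenius_power r pK.
by rewrite -!tauE => /fmorph_inj.
Qed.

Section AlgebraicClosure.
Variables (p : nat) (F : closedFieldType) (j : {rmorphism 'F_p -> F}).
Hypotheses (p_pr : prime p) (F_closure : is_algebraic_closure_of_Fp j).

Lemma pchar_closure : p \in [pchar F].
Proof. by rewrite (fmorph_pchar j) pchar_Fp. Qed.

Lemma frobenius_period_mul (x : F) r k :
  x ^+ (p ^ r) = x -> x ^+ (p ^ (r * k)) = x.
Proof.
move=> xr; elim: k => [|k IHk]; first by rewrite muln0 expr1.
by rewrite mulnS expnD exprM xr.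
Qed.

(** The conjugates [x ^ (p ^ i)] are roots of one polynomial over the prime
    field, hence two of them agree. *)
Lemma frobenius_periodic (x : F) : exists2 r, (0 < r)%N & x ^+ (p ^ r) = x.
Proof.
have [q nz_q qx] := F_closure x.
have pF := pchar_closure.
have root_frob i : root (map_poly j q) (x ^+ (p ^ i)).
  have [tau tauE] := frobenius_power i pF.
  have [tau0 tau0E] := frobenius_power i (pchar_Fp p_pr).
  have tau0_id c : tau0 c = c.
    rewrite tau0E; elim: i {tau tauE tau0E} => [|i IHi]; first by rewrite expr1.
    by rewrite expnSr exprM IHi -{2}[c]expf_card card_Fp.
  rewrite -tauE.
  have <- : map_poly tau (map_poly j q) = map_poly j q.
    apply/polyP=> k; rewrite !coef_map /= tauE -rmorphXn -tau0E.
    by rewrite tau0_id.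
  by rewrite fmorph_root.
pose rs := [seq x ^+ (p ^ i) | i <- iota 0 (size q)].
have nz_jq : map_poly j q != 0 by rewrite map_poly_eq0.
have [uniq_rs|] := boolP (uniq rs).
  have all_rs : all (root (map_poly j q)) rs by apply/allP=> _ /mapP[i _ ->].
  have := max_poly_roots nz_jq all_rs uniq_rs.
  by rewrite size_map size_iota size_map_poly ltnn.
move/(uniqPn 0) => [i [k [lt_ik]]]; rewrite size_map size_iota => lt_k.
rewrite !(nth_map 0) ?size_iota ?(ltn_trans lt_ik) // !nth_iota ?(ltn_trans lt_ik) //.
rewrite !add0n => eq_ik; exists (k - i)%N; first by rewrite subn_gt0.
apply: (frobenius_inj (r := i) pF); rewrite /= -exprM -expnD subnK //.
exact: ltnW.
Qed.

Lemma frobenius_periodic_seq (cs : seq F) :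
  exists2 r, (0 < r)%N & {in cs, forall x, x ^+ (p ^ r) = x}.
Proof.
elim: cs => [|c cs [r r_gt0 csr]]; first by exists 1.
have [k k_gt0 ck] := frobenius_periodic c.
exists (r * k)%N; first by rewrite muln_gt0 r_gt0.
move=> x; rewrite inE => /predU1P[->|/csr/frobenius_period_mul//].
by rewrite mulnC frobenius_period_mul.
Qed.

Lemma primitive_root_exists n : (0 < n)%N -> coprime p n ->
  exists z : F, n.-primitive_root z.
Proof.
move=> n_gt0 co_pn.
have [r Dp] := closed_field_poly_normal ('X^n - 1 : {poly F}).
have lc1 : lead_coef ('X^n - 1 : {poly F}) = 1.
  by rewrite (eqP (monicXnsubC 1 n_gt0)).
rewrite lc1 scale1r in Dp.
have r_unity : all n.-unity_root r.
  apply/allP=> x; rewrite -root_prod_XsubC -Dp unity_rootE.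
  by rewrite /root !hornerE subr_eq0.
have size_r : (n <= size r)%N.
  by rewrite -ltnS -(size_prod_XsubC r id) -Dp size_XnsubC.
have uniq_r : uniq r.
  rewrite -separable_prod_XsubC -Dp separable_Xn_sub_1 //.
  by rewrite -(dvdn_pcharf pchar_closure) -prime_coprime.
by have /hasP[z _ prim_z] := has_prim_root n_gt0 r_unity uniq_r size_r; exists z.
Qed.

Lemma primitive_coprime n (z : F) : n.-primitive_root z -> coprime p n.
Proof.
move=> prim_z; rewrite prime_coprime // (dvdn_pcharf pchar_closure).
exact: prim_root_natf_neq0 prim_z.
Qed.
End AlgebraicClosure.

Lemma primitive_order_bounded (F : fieldType) (rs : seq F) :
  exists K, forall z n, z \in rs -> n.-primitive_root z -> (n <= K)%N.
Proof.
elim: rs => [|a rs [K K_rs]]; first by exists 0.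
have [[m prim_a]|no_m] := classic (exists m, m.-primitive_root a).
  exists (maxn m K) => z n; rewrite inE => /predU1P[->|z_rs] prim_z.
    rewrite leq_max dvdn_leq ?(prim_order_gt0 prim_a) //.
    by rewrite (prim_order_dvd prim_z) prim_expr_order.
  by rewrite leq_max (K_rs z) ?orbT.
exists K => z n; rewrite inE => /predU1P[-> prim_z|]; last exact: K_rs.
by case: no_m; exists n.
Qed.

Lemma primitive_avoids_roots (F : closedFieldType) (u : {poly F}) : u != 0 ->
  exists K, forall z n, (K < n)%N -> n.-primitive_root z -> u.[z] != 0.
Proof.
move=> nz_u; have [rs Du] := closed_field_poly_normal u.
have [K K_rs] := primitive_order_bounded rs.
exists K => z n lt_Kn prim_z; apply/negP=> uz.
have z_rs : z \in rs.
  by move: uz; rewrite -/(root u z) Du rootZ ?lead_coef_eq0 // root_prod_XsubC.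
by have := K_rs z n z_rs prim_z; rewrite leqNgt lt_Kn.
Qed.

(** * Cyclotomic polynomials in characteristic p *)

Lemma primitive_order_unique (K : idomainType) (z : K) m n :
  m.-primitive_root z -> n.-primitive_root z -> m = n.
Proof.
move=> prim_m prim_n; apply/eqP; rewrite eqn_dvd.
by rewrite (prim_order_dvd prim_m) (prim_order_dvd prim_n) !prim_expr_order ?eqxx.
Qed.

Section Cyclotomic.
Variables (K : fieldType) (p : nat).
Hypothesis pK : p \in [pchar K].
Local Notation Psi n := (map_poly intr 'Phi_n : {poly K}).

Lemma prod_cyclotomic_field k : (0 < k)%N ->
  'X^k - 1 = \prod_(d <- divisors k) Psi d.
Proof.
by move=> k_gt0; rewrite -rmorph_prod prod_Cyclotomic //= rmorphB rmorph1 /= map_polyXn.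
Qed.

Lemma cyclotomic_quotient m m' : (0 < m)%N -> (m' %| m)%N ->
  'X^m - 1 = ('X^m' - 1) * \prod_(d <- divisors m | ~~ (d %| m')%N) Psi d.
Proof.
move=> m_gt0 m'_m; have m'_gt0 := dvdn_gt0 m_gt0 m'_m.
rewrite !prod_cyclotomic_field // (bigID (fun d => d %| m')%N) /=; congr (_ * _).
rewrite -big_filter; apply: perm_big; apply: uniq_perm.
- by rewrite filter_uniq // divisors_uniq.
- exact: divisors_uniq.
move=> d; rewrite mem_filter -!dvdn_divisors //.
by have [d_m'|//] := boolP (d %| m')%N; rewrite (dvdn_trans d_m').
Qed.

Lemma Xn_sub1_frobenius n e :
  'X^(n * p ^ e) - 1 = ('X^n - 1) ^+ (p ^ e) :> {poly K}.
Proof.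
have pKX : p \in [pchar {poly K}] by rewrite pchar_poly.
have [tau tauE] := frobenius_power e pKX.
by rewrite -tauE rmorphB rmorph1 tauE exprM.
Qed.

Lemma Xn_sub1_neq0 n : (0 < n)%N -> 'X^n - 1 != 0 :> {poly K}.
Proof. by move=> n_gt0; rewrite -size_poly_gt0 size_XnsubC. Qed.

(** Modulo [p] one has ['X^(n p^e) - 1 = ('X^n - 1)^(p^e)], so a root [z] of
    [Psi (n p^e)] satisfies [z^n = 1]. If its order [d] were a proper divisor of
    [n], then [Psi (n p^e)] would divide the [p^e]-th power of
    [('X^n - 1) / ('X^d - 1)], whose value at [z] is [n / d], which is nonzero
    in characteristic [p]. *)
Lemma cyclotomic_root_primitive n e (z : K) : (0 < n)%N -> coprime p n ->
  (Psi (n * p ^ e)%N).[z] = 0 -> n.-primitive_root z.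
Proof.
move=> n_gt0 co_pn Psi_z; have p_pr := pcharf_prime pK.
set m := (n * p ^ e)%N in Psi_z.
have pe_gt0 : (0 < p ^ e)%N by rewrite expn_gt0 prime_gt0.
have m_gt0 : (0 < m)%N by rewrite muln_gt0 n_gt0.
have zn : z ^+ n = 1.
  apply: (frobenius_inj (r := e) pK); rewrite /= expr1n -exprM; apply/eqP.
  have /(congr1 (horner^~ z)) := prod_cyclotomic_field m_gt0.
  rewrite (bigD1_seq m) -?dvdn_divisors ?divisors_uniq //=.
  by rewrite !hornerE Psi_z mul0r => /eqP; rewrite subr_eq0.
have [d prim_d d_n] := prim_order_exists n_gt0 zn.
have d_gt0 := prim_order_gt0 prim_d.
have [-> //|ne_dn] := eqVneq n d.
have dpe_m : (d * p ^ e %| m)%N by rewrite dvdn_pmul2r.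
have m_ndpe : ~~ (m %| d * p ^ e)%N.
  by rewrite dvdn_pmul2r //; apply: contra ne_dn => n_d; rewrite eqn_dvd n_d.
have := cyclotomic_quotient m_gt0 dpe_m.
rewrite -big_filter (bigD1_seq m) ?mem_filter -?dvdn_divisors ?m_ndpe //=; last first.
  by rewrite filter_uniq // divisors_uniq.
rewrite !Xn_sub1_frobenius -(divnK d_n) mulnC exprM subrX1 exprMn => /mulfI.
rewrite expf_neq0 ?Xn_sub1_neq0 // => /(_ isT)/(congr1 (horner^~ z)).
rewrite hornerM Psi_z mul0r horner_exp => /eqP; rewrite expf_eq0 => /andP[_].
rewrite horner_sum (eq_bigr (fun=> 1)) => [|i _]; last first.
  by rewrite horner_exp hornerXn (prim_expr_order prim_d) expr1n.
rewrite big_const_ord iter_addr_0 -(dvdn_pcharf pK) => p_nd.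
move: co_pn; rewrite prime_coprime // -(divnK d_n) => /negP[].
exact: dvdn_mulr.
Qed.

(** The quotient of ['X^(n p^(e+1)) - 1] by ['X^(n p^e) - 1] is a positive
    power of ['X^n - 1] and thus vanishes at [z]. It is the product of the
    [Psi d] for [d = d0 p^(e+1)] with [d0] dividing [n], and by the previous
    lemma only [d0 = n] can contribute. *)
Lemma primitive_cyclotomic_root n e (z : K) : n.-primitive_root z ->
  (Psi (n * p ^ e.+1)%N).[z] = 0.
Proof.
move=> prim_z; have p_pr := pcharf_prime pK.
have n_gt0 := prim_order_gt0 prim_z.
set m := (n * p ^ e.+1)%N; set m' := (n * p ^ e)%N.
have m_gt0 : (0 < m)%N by rewrite muln_gt0 n_gt0 expn_gt0 prime_gt0.
have m'_m : (m' %| m)%N by rewrite dvdn_pmul2l // dvdn_exp2l.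
have lt_pe : (p ^ e < p ^ e.+1)%N by rewrite ltn_exp2l // prime_gt1.
have := cyclotomic_quotient m_gt0 m'_m.
rewrite !Xn_sub1_frobenius -(subnKC (ltnW lt_pe)) exprD => /mulfI.
rewrite expf_neq0 ?Xn_sub1_neq0 // => /(_ isT)/(congr1 (horner^~ z))/esym.
rewrite horner_exp hornerD hornerN hornerC hornerXn (prim_expr_order prim_z) subrr.
rewrite expr0n subn_eq0 leqNgt lt_pe horner_prod => /eqP.
rewrite prodf_seq_eq0 => /hasP[d]; rewrite -dvdn_divisors // => d_m /andP[d_m' /eqP Pd].
have d_gt0 := dvdn_gt0 m_gt0 d_m.
have [d0 co_pd0 Dd] := pfactor_coprime p_pr d_gt0; set f := logn p d in Dd.
have d0_gt0 : (0 < d0)%N by move: d_gt0; rewrite Dd muln_gt0 => /andP[].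
have prim_d0 : d0.-primitive_root z.
  by apply: (@cyclotomic_root_primitive d0 f) => //; rewrite -Dd.
have Dn := primitive_order_unique prim_d0 prim_z.
have f_le : (f <= e.+1)%N.
  by rewrite -(@dvdn_Pexp2l p) ?prime_gt1 // -(@dvdn_pmul2l n) // -{1}Dn -Dd.
have f_gt : ~~ (f <= e)%N.
  by rewrite -(@dvdn_Pexp2l p) ?prime_gt1 // -(@dvdn_pmul2l n) // -{1}Dn -Dd.
have Df : f = e.+1 by apply/eqP; rewrite eqn_leq f_le ltnNge.
by rewrite /m -Df -Dn -Dd.
Qed.
End Cyclotomic.

(** * Bounding common zeros by a resultant *)

Section Resultant.
Variable F : fieldType.
Implicit Types f g : {poly {poly F}}.

(** The coefficients are polynomials in [X], and the main variable is [Y]. *)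
Definition eval2 (alpha beta : F) (f : {poly {poly F}}) : F :=
  (map_poly (horner_eval alpha) f).[beta].

Lemma eval2M alpha beta f g :
  eval2 alpha beta (f * g) = eval2 alpha beta f * eval2 alpha beta g.
Proof. by rewrite /eval2 rmorphM hornerM. Qed.

Lemma eval2D alpha beta f g :
  eval2 alpha beta (f + g) = eval2 alpha beta f + eval2 alpha beta g.
Proof. by rewrite /eval2 rmorphD hornerD. Qed.

Lemma eval2C alpha beta (q : {poly F}) : eval2 alpha beta q%:P = q.[alpha].
Proof. by rewrite /eval2 map_polyC hornerC. Qed.

(** Leibniz formula for the determinant of the Sylvester matrix. *)
Lemma size_resultant f g a b :
    (forall k, (size (f`_k)%R <= a.+1)%N) -> (forall k, (size (g`_k)%R <= b.+1)%N) ->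
  (size (resultant f g) <= (a * (size g).-1 + b * (size f).-1).+1)%N.
Proof.
move=> f_a g_b; rewrite /resultant /determinant.
apply: leq_trans (size_sum _ _ _) _; apply/bigmax_leqP => s _.
have size_sign (c : bool) (q : {poly F}) : size ((-1) ^+ c * q) = size q.
  by case: c; rewrite ?expr1 ?expr0 ?mulN1r ?mul1r ?size_polyN.
rewrite size_sign.
apply: leq_trans (size_poly_prod_leq _ _) _; rewrite leq_subLR card_ord addnS ltnS.
rewrite big_split_ord /=.
apply: (@leq_trans ((size g).-1 * a.+1 + (size f).-1 * b.+1)); last first.
  by rewrite !mulnS (mulnC a) (mulnC b) addnACA.
apply: leq_add.
  rewrite -[X in (_ <= X * _)%N]card_ord -sum_nat_const; apply: leq_sum => i _.
  rewrite Sylvester_mxE; case: splitP => /= k Dk; last by have := ltn_ord i; lia.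
  by rewrite mulrb; case: ifP; rewrite ?size_poly0 ?f_a.
rewrite -[X in (_ <= X * _)%N]card_ord -sum_nat_const; apply: leq_sum => i _.
rewrite Sylvester_mxE; case: splitP => /= k Dk; first by have := ltn_ord k; lia.
by rewrite mulrb; case: ifP; rewrite ?size_poly0 ?g_b.
Qed.

(** A weak form of the theorem of Bezout, which counts abscissas: the resultant
    with respect to [Y] vanishes at each of them. *)
Lemma common_zeros_bound f g a b (rs : seq F) :
    (1 < size f)%N -> (1 < size g)%N -> resultant f g != 0 ->
    (forall k, (size (f`_k)%R <= a.+1)%N) -> (forall k, (size (g`_k)%R <= b.+1)%N) ->
    uniq rs ->
    (forall alpha, alpha \in rs ->
       exists beta, eval2 alpha beta f = 0 /\ eval2 alpha beta g = 0) ->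
  (size rs <= a * (size g).-1 + b * (size f).-1)%N.
Proof.
move=> f_gt1 g_gt1 nz_res f_a g_b uniq_rs zeros; rewrite -ltnS.
apply: leq_trans (size_resultant f_a g_b).
apply: max_poly_roots => //; apply/allP=> alpha /zeros[beta [f0 g0]].
have [[u v] _ /(congr1 (eval2 alpha beta))] := resultant_in_ideal f_gt1 g_gt1.
by rewrite eval2C eval2D !eval2M f0 g0 !mulr0 addr0 => /eqP.
Qed.

Lemma eval2_rmorph (tau : {rmorphism F -> F}) alpha beta f :
    (forall k i, tau f`_k`_i = f`_k`_i) -> eval2 alpha beta f = 0 ->
  eval2 (tau alpha) (tau beta) f = 0.
Proof.
move=> tau_f f0.
suff -> : eval2 (tau alpha) (tau beta) f = tau (eval2 alpha beta f).
  by rewrite f0 rmorph0.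
rewrite /eval2 -horner_map -map_poly_comp; congr (_.[_]).
apply/polyP=> k; rewrite !coef_map /= /horner_eval -horner_map; congr (_.[_]).
by apply/polyP=> i; rewrite coef_map /= tau_f.
Qed.

End Resultant.

Section MinimalRelation.
Variables (K R : idomainType) (e : {rmorphism K -> R}) (b : R).

(** A polynomial of least degree among those vanishing at [b] divides, over the
    fraction field, any polynomial with which it has a common factor. *)
Lemma minimal_relation_common_factor (f g : {poly K}) :
    injective e -> f != 0 -> (map_poly e f).[b] = 0 ->
    (forall h : {poly K}, h != 0 -> (map_poly e h).[b] = 0 -> (size f <= size h)%N) ->
  (1 < size (gcdp f g))%N -> (map_poly e g).[b] = 0.
Proof.
move=> e_inj nz_f f0 min_f; set d := gcdp f g => d_gt1.
have e_neq0 c : c != 0 -> e c != 0.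
  by apply: contraNneq => ec0; apply/eqP/e_inj; rewrite ec0 rmorph0.
have /Pdiv.Idomain.dvdpP[[c h] /= nz_c Df] : d %| f := dvdp_gcdl f g.
have /Pdiv.Idomain.dvdpP[[c' h'] /= nz_c' Dg] : d %| g := dvdp_gcdr f g.
have ev q1 q2 q3 c0 : c0 *: q1 = q2 * q3 ->
    e c0 * (map_poly e q1).[b] = (map_poly e q2).[b] * (map_poly e q3).[b].
  move/(congr1 (fun q => (map_poly e q).[b])).
  by rewrite rmorphM /= map_polyZ !hornerE.
have nz_hd : h * d != 0.
  by rewrite -Df -mul_polyC mulf_neq0 // polyC_eq0.
have [nz_h nz_d] := norP (etrans (esym (congr1 negb (mulf_eq0 _ _))) nz_hd).
have size_hd : (size h < size f)%N.
  have := congr1 (fun q : {poly K} => size q) Df.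
  rewrite /= size_scale // size_mul // => ->.
  by move: d_gt1; case: (size d) => [|[|m]] // _; rewrite !addnS /= ltnS leq_addr.
have d0 : (map_poly e d).[b] = 0.
  have /esym/eqP := ev _ _ _ _ Df; rewrite f0 mulr0 mulf_eq0 => /orP[/eqP h0|/eqP//].
  by have := min_f h nz_h h0; rewrite leqNgt size_hd.
have /eqP := ev _ _ _ _ Dg; rewrite d0 mulr0 mulf_eq0 => /orP[e0|/eqP//].
by have := e_neq0 _ nz_c'; rewrite e0.
Qed.
End MinimalRelation.

(** Dirichlet's box principle for exponents. *)
Lemma small_exponent_relation (F : fieldType) (n M : nat) (z w : F) :
    n.-primitive_root z -> w ^+ n = 1 -> (n < M.+1 ^ 2)%N ->
  exists i j i' j', [/\ [&& (i <= M)%N, (j <= M)%N, (i' <= M)%N & (j' <= M)%N],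
    (i, j) != (i', j') & z ^+ i * w ^+ j = z ^+ i' * w ^+ j'].
Proof.
move=> prim_z wn lt_nM; have [s Dw] := prim_rootP prim_z wn.
have n_gt0 := prim_order_gt0 prim_z.
pose h (x : 'I_M.+1 * 'I_M.+1) : 'I_n := Ordinal (ltn_pmod (x.1 + s * x.2) n_gt0).
have [x [y [ne_xy Dh]]] : exists x y, x != y /\ h x = h y.
  apply: NNPP => inj_h; have /leq_card : injective h.
    move=> x y Dh; apply/eqP; apply: contraT => ne_xy.
    by case: inj_h; exists x, y.
  by rewrite card_prod !card_ord mulnn leqNgt lt_nM.
exists x.1, x.2, y.1, y.2; split.
- by apply/and4P; split; rewrite -ltnS ltn_ord.
- by apply: contra ne_xy; case: x y {Dh} => [i j] [i' j'].
rewrite Dw -!exprM -!exprD -(prim_expr_mod prim_z) -[RHS](prim_expr_mod prim_z).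
by congr (_ ^+ _); move/(congr1 val): Dh.
Qed.

(** * A multiplicative relation *)

Section MultiplicativeRelation.
Variables (p : nat) (F : closedFieldType) (j : {rmorphism 'F_p -> F}).
Hypotheses (p_pr : prime p) (F_closure : is_algebraic_closure_of_Fp j).

Lemma frobenius_fixed_coefs (f : {poly {poly F}}) :
  exists2 r, (0 < r)%N & forall k i, f`_k`_i ^+ (p ^ r) = f`_k`_i.
Proof.
have [r r_gt0 r_fix] := frobenius_periodic_seq p_pr F_closure
  (flatten [seq (q : seq F) | q : {poly F} <- f]).
exists r => // k i.
have zero_fix : (0 : F) ^+ (p ^ r) = 0.
  by rewrite expr0n expn_eq0 -leqn0 leqNgt prime_gt0.
have [lt_k|le_k] := ltnP k (size f); last first.
  by rewrite (nth_default _ le_k) coef0.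
have [lt_i|le_i] := ltnP i (size f`_k); last by rewrite (nth_default _ le_i).
apply: r_fix; apply/flattenP; exists (f`_k : seq F); last exact: mem_nth.
by apply/mapP; exists f`_k => //; apply: mem_nth.
Qed.

Variables (R : idomainType) (iota : {rmorphism F -> R}) (A B : R).

Definition specialises (x : {rmorphism R -> F}) := forall c, x (iota c) = c.

Lemma specialise_eval2 (x : {rmorphism R -> F}) (f : {poly {poly F}}) :
    specialises x ->
  x (map_poly (horner_eval A \o map_poly iota) f).[B] = eval2 (x A) (x B) f.
Proof.
move=> xK; rewrite -horner_map -map_poly_comp; congr (_.[_]).
apply: eq_map_poly => q /=; rewrite /horner_eval -horner_map -map_poly_comp.
by congr (_.[_]); apply: map_poly_id => c _; apply: xK.
Qed.

(** The common zeros forced by Frobenius outnumber the bound that the resultant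
    gives. An equation [f] of minimal degree in [Y] plays the part of an
    irreducible equation of the image of the curve under [(A, B)]. *)
Lemma multiplicative_relation (f0 : {poly {poly F}}) (u : {poly F}) :
    ~ (exists c, A = iota c) ->
    f0 != 0 -> (map_poly (horner_eval A \o map_poly iota) f0).[B] = 0 ->
    u != 0 -> (forall alpha, u.[alpha] != 0 ->
      exists x : {rmorphism R -> F}, specialises x /\ x A = alpha) ->
    (forall (x : {rmorphism R -> F}) n, specialises x ->
      n.-primitive_root (x A) -> x B ^+ n = 1) ->
  exists i1 j1 i2 j2, j1 != j2 /\ A ^+ i1 * B ^+ j1 = A ^+ i2 * B ^+ j2.
Proof.
move=> A_nc nz_f0 f0_AB nz_u dom ordB.
pose e : {rmorphism {poly F} -> R} := horner_eval A \o map_poly iota.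
have eE q : e q = (map_poly iota q).[A] by [].
have e_inj : injective e.
  move=> q1 q2 /eqP; rewrite -subr_eq0 -rmorphB => /eqP.
  by move/(nonconstant_transcendental A_nc)/eqP; rewrite subr_eq0 => /eqP.
pose P (q : {poly {poly F}}) := q != 0 /\ (map_poly e q).[B] = 0.
have [|f [[nz_f f_AB] min_f]] :=
    exists_minimal (fun q : {poly {poly F}} => size q) (P := P).
  by exists f0.
have f_gt1 : (1 < size f)%N.
  rewrite ltnNge; apply/negP=> /size1_polyC Df.
  move: nz_f f_AB; rewrite Df map_polyC hornerC polyC_eq0 => nz_c /= c0.
  by move: nz_c; rewrite (e_inj f`_0 0) ?eqxx // rmorph0.
have [r r_gt0 fix_f] := frobenius_fixed_coefs f.
have [K avoid_u] := primitive_avoids_roots nz_u.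
(* any odd prime other than [p] would do *)
pose l := (if p == 3 then 5 else 3)%N.
have l_pr : prime l by rewrite /l; case: ifP.
have l_odd : odd l by rewrite /l; case: ifP.
have co_pl : coprime p l.
  rewrite prime_coprime // dvdn_prime2 // /l.
  by have [->|] := eqVneq p 3.
(* the factor [totient l] makes [Q] congruent to [1] modulo [l] *)
pose Q := (p ^ (r * totient l))%N.
have Q1 : Q = 1 %[mod l].
  by rewrite /Q mulnC expnM -modnXm Euler_exp_totient // modnXm exp1n.
have Q_gt1 : (1 < Q)%N.
  rewrite -(exp1n (r * totient l)) ltn_exp2r ?prime_gt1 //.
  by rewrite muln_gt0 r_gt0 totient_gt0 prime_gt0.
pose c := logn l Q.-1.
pose a := (\max_(k < size f) size (f`_k)%R)%N.
have f_a k : (size (f`_k)%R <= a.+1)%N.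
  have [lt_k|le_k] := ltnP k (size f); last by rewrite nth_default // size_poly0.
  by apply: leqW; apply: (leq_bigmax (Ordinal lt_k)).
(* [h] is so large that the conjugates of [alpha], of which there are at least
   [l ^ (h + h)], outnumber the common zeros, of which there are at most
   [(a + (size f).-1) * l ^ (c + h)]; the order [n] exceeds [K] so that [alpha]
   avoids the roots of [u] *)
have [h [lt_Kh le_ch lt_h]] :
    exists h, [/\ (K < h)%N, (c <= h)%N & (a + (size f).-1 <= h - c)%N].
  exists (c + (a + (size f).-1 + K)).+1; split.
  - by rewrite ltnS addnA leq_addl.
  - by rewrite leqW ?leq_addr.
  - by rewrite -addnS addKn -addnS leq_addr.
pose M := (l ^ (c + h))%N.
pose n := (l ^ (c + (h + h)))%N.
have l_gt1 := prime_gt1 l_pr.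
have n_gt0 : (0 < n)%N by rewrite expn_gt0 prime_gt0.
have lt_Kn : (K < n)%N.
  apply: leq_ltn_trans (ltn_expl (c + (h + h)) l_gt1).
  by rewrite addnA (leq_trans (ltnW lt_Kh)) ?leq_addl.
have co_pn : coprime p n by rewrite coprimeXr.
have [alpha prim_alpha] := primitive_root_exists j p_pr n_gt0 co_pn.
have [x [xK xA]] := dom alpha (avoid_u alpha n lt_Kn prim_alpha).
pose beta := x B.
have beta_n : beta ^+ n = 1 by apply: ordB => //; rewrite xA.
have nM : (n < M.+1 ^ 2)%N.
  apply: (@leq_ltn_trans (M ^ 2)); last by rewrite ltn_exp2r.
  by rewrite /n /M -expnM leq_exp2l // muln2 -addnn addnA leq_add2l leq_addl.
have lt_Mn : (M < n)%N.
  rewrite ltn_exp2l // ltn_add2l -[X in (X < _)%N]addn0 ltn_add2l.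
  exact: leq_ltn_trans lt_Kh.
have [i1 [j1 [i2 [j2 []]]]] := small_exponent_relation prim_alpha beta_n nM.
case/and4P=> le_i1 le_j1 le_i2 le_j2 ne_ij rel_ab.
have nz_beta : beta != 0.
  by apply: contra_eq_neq beta_n => ->; rewrite expr0n gtn_eqF // eq_sym oner_eq0.
have ne_j : j1 != j2.
  apply: contraNneq ne_ij => Dj; rewrite Dj in rel_ab *.
  move/mulIf: rel_ab => /(_ (expf_neq0 _ nz_beta))/eqP.
  rewrite (eq_prim_root_expr prim_alpha) !modn_small ?(leq_ltn_trans _ lt_Mn) //.
  by move/eqP->.
exists i1, j1, i2, j2; split=> //.
pose mon i k : {poly {poly F}} := ('X^i)%:P * 'X^k.
pose g := mon i1 j1 - mon i2 j2.
have mon_coef i k m : (mon i k)`_m = if m == k then 'X^i else 0.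
  by rewrite coefCM coefXn; case: eqP; rewrite ?mulr1 ?mulr0.
have g_M m : (size (g`_m)%R <= M.+1)%N.
  rewrite coefB !mon_coef; apply: leq_trans (size_polyD _ _) _.
  rewrite size_polyN geq_max; apply/andP; split; case: ifP => _;
    by rewrite ?size_poly0 ?size_polyXn ?ltnS.
have size_g : (size g <= M.+1)%N.
  apply/leq_sizeP => m lt_Mm; rewrite coefB !mon_coef.
  by rewrite !gtn_eqF ?subrr //; apply: leq_ltn_trans lt_Mm.
have g_gt1 : (1 < size g)%N.
  have g_big k : (0 < k)%N -> g`_k != 0 -> (1 < size g)%N.
    move=> k_gt0 nz_gk; rewrite ltnNge; apply/negP=> g_le1.
    by move: nz_gk; rewrite nth_default ?eqxx // (leq_trans g_le1).
  have [j10|j1_gt0] := posnP j1.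
    apply: (g_big j2); first by rewrite lt0n -j10 eq_sym.
    rewrite coefB !mon_coef eqxx [j2 == j1]eq_sym (negPf ne_j) sub0r oppr_eq0.
    by rewrite -size_poly_gt0 size_polyXn.
  apply: (g_big j1) => //.
  by rewrite coefB !mon_coef eqxx (negPf ne_j) subr0 -size_poly_gt0 size_polyXn.
have eval_mon i k a1 b1 : eval2 a1 b1 (mon i k) = a1 ^+ i * b1 ^+ k.
  by rewrite eval2M eval2C hornerXn /eval2 map_polyXn hornerXn.
have eval_g a1 b1 : eval2 a1 b1 g = a1 ^+ i1 * b1 ^+ j1 - a1 ^+ i2 * b1 ^+ j2.
  by rewrite -!eval_mon /eval2 rmorphB hornerD hornerN.
have res0 : resultant f g = 0.
  apply/eqP; apply: contraT => nz_res.
  pose rs := [seq alpha ^+ (Q ^ i)%N | i <- seq.iota 0 (l ^ (h + h))%N].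
  have uniq_rs : uniq rs.
    rewrite map_inj_in_uniq ?iota_uniq // => i k.
    rewrite !mem_iota !add0n !leq0n => /= lt_i lt_k /eqP.
    rewrite (eq_prim_root_expr prim_alpha) => /eqP.
    exact: order_growth.
  have := common_zeros_bound f_gt1 g_gt1 nz_res f_a g_M uniq_rs.
  rewrite size_map size_iota => bound.
  suff : (a * (size g).-1 + M * (size f).-1 < l ^ (h + h))%N.
    rewrite ltnNge => /negP[]; apply: bound => _ /mapP[i _ ->].
    have [tau tauE] := frobenius_power (r * totient l * i) (pchar_closure j p_pr).
    have tauQ y : tau y = y ^+ (Q ^ i) by rewrite tauE /Q -expnM.
    exists (beta ^+ (Q ^ i)); split.
      rewrite -!tauQ; apply: eval2_rmorph => [k m|].
        by rewrite tauE -mulnA frobenius_period_mul.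
      by rewrite /beta -xA -specialise_eval2 // f_AB rmorph0.
    by rewrite eval_g -!exprM !(mulnC (Q ^ i)%N) !exprM -!exprMn rel_ab subrr.
  apply: (@leq_ltn_trans (M * (a + (size f).-1))).
    rewrite mulnDr leq_add2r mulnC leq_mul2r; apply/orP; right.
    by rewrite -subn1 leq_subLR add1n.
  rewrite /M (_ : l ^ (h + h) = l ^ (c + h) * l ^ (h - c))%N; last first.
    by rewrite -expnD [in RHS]addnC addnA subnK.
  rewrite ltn_pmul2l ?expn_gt0 ?prime_gt0 //.
  by apply: leq_trans (ltn_expl _ l_gt1) _; rewrite leq_exp2l.
have g_AB : (map_poly e g).[B] = 0.
  apply: (minimal_relation_common_factor (f := f)) => //.
    by move=> q nz_q q0; apply: min_f.
  by rewrite -resultant_eq0 res0.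
have mon_AB i k : (map_poly e (mon i k)).[B] = A ^+ i * B ^+ k.
  rewrite rmorphM hornerM /= map_polyC hornerC map_polyXn hornerXn; congr (_ * _).
  by rewrite /= /horner_eval map_polyXn hornerXn.
apply/eqP; rewrite -subr_eq0 -!mon_AB -hornerN -hornerD -rmorphB.
by apply/eqP.
Qed.
End MultiplicativeRelation.

(** * From the relation to powers of Frobenius *)

(** The points of the curve are among the prime ideals of [R]. *)
Lemma kernel_prime_ideal (R : idomainType) (L : fieldType) (x : {rmorphism R -> L}) :
  exists P : prime_idealr R, forall a, (a \in P) = (x a == 0).
Proof.
pose S : {pred R} := fun a => x a == 0.
have SE a : (a \in S) = (x a == 0) by [].
have Sideal : idealr_closed S.
  split=> [||a u v]; rewrite !SE ?rmorph0 ?rmorph1 ?oner_eq0 //.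
  by move=> /eqP u0 /eqP v0; rewrite rmorphD rmorphM u0 v0 mulr0 addr0.
have Sprime : prime_idealr_closed S by move=> u v; rewrite !SE rmorphM mulf_eq0.
pose P : prime_idealr R := HB.pack S (isIdealr.Build R S Sideal)
  (isPrimeIdealrClosed.Build R S Sprime).
by exists P.
Qed.

(** A relation with a negative exponent cannot be specialised in the fraction
    field; it is first multiplied out. *)
Lemma eval_fraction_relation (R : idomainType) (L : fieldType) (x : {rmorphism R -> L})
    (a b c : R) m (k : int) :
    x a != 0 -> tofrac b ^+ m = tofrac c * tofrac a ^ k ->
  x b ^+ m = x c * x a ^ k.
Proof.
move=> nz_xa; case: k => k.
  rewrite -!exprnP -!tofracXn -tofracM => /eqP; rewrite tofrac_eq => /eqP.
  by rewrite -rmorphXn => ->; rewrite rmorphM rmorphXn.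
have nz_a : tofrac a != 0.
  by rewrite tofrac_eq0; apply: contraNneq nz_xa => ->; rewrite rmorph0.
rewrite NegzE -!exprnN => Db.
have /eqP : tofrac (b ^+ m * a ^+ k.+1) = tofrac c.
  by rewrite tofracM !tofracXn Db mulfVK ?expf_neq0.
rewrite tofrac_eq => /eqP <-.
by rewrite rmorphM !rmorphXn mulfK // expf_neq0.
Qed.

Lemma prim_expz_eq1 (F : fieldType) (n : nat) (z : F) (k : int) :
  n.-primitive_root z -> (n %| `|k|)%N -> z ^ k = 1.
Proof.
move=> prim_z; case: k => k /=; rewrite (prim_order_dvd prim_z) => /eqP zk.
  by rewrite -exprnP.
by rewrite NegzE -exprnN zk invr1.
Qed.

Lemma prim_expz_dvd (F : fieldType) (n d t : nat) (z : F) (k : int) :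
    n.-primitive_root z -> z ^+ t = z ^ k -> (d %| n)%N -> (d %| t)%N ->
  (d %| `|k|)%N.
Proof.
move=> prim_z; case: k => k.
  rewrite -exprnP => /eqP; rewrite (eq_prim_root_expr prim_z) => /eqP eq_tk d_n /=.
  by rewrite /dvdn -(modn_dvdm t d_n) eq_tk modn_dvdm.
rewrite NegzE -exprnN => eq_tk d_n d_t.
have nz_z : z != 0 by rewrite (prim_root_eq0 prim_z) lt0n_neq0 ?(prim_order_gt0 prim_z).
have n_tk : (n %| t + k.+1)%N.
  by rewrite (prim_order_dvd prim_z) exprD eq_tk mulVf ?expf_neq0.
by rewrite abszN absz_nat -(dvdn_addr _ d_t) (dvdn_trans d_n).
Qed.

Lemma algebraic_constant (F : closedFieldType) (R : idomainType)
    (iota : {rmorphism F -> R}) (a : R) n :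
  (0 < n)%N -> a ^+ n = 1 -> exists c, a = iota c.
Proof.
move=> n_gt0 an; apply: NNPP => a_nc.
have Xn0 : (map_poly iota ('X^n - 1)).[a] = 0.
  by rewrite rmorphB rmorph1 /= map_polyXn hornerD hornerN hornerC hornerXn an subrr.
have /eqP := nonconstant_transcendental a_nc Xn0.
by rewrite -size_poly_eq0 size_XnsubC.
Qed.

Section PowerRelation.
Variables (p : nat) (F : closedFieldType) (j : {rmorphism 'F_p -> F}).
Hypothesis p_pr : prime p.
Variables (R : idomainType) (iota : {rmorphism F -> R}) (A B : R).
Hypotheses (A_nc : ~ (exists c, A = iota c)) (B_nc : ~ (exists c, B = iota c)).
Variable u : {poly F}.
Hypotheses (nz_u : u != 0)
  (dom : forall alpha, u.[alpha] != 0 ->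
     exists x : {rmorphism R -> F}, specialises iota x /\ x A = alpha).

(** The order is a power of a given [q], so that it can be large enough to
    avoid the exceptional values and still have the prime divisors of [q]. *)
Lemma specialisation_of_order q : (1 < q)%N -> coprime p q ->
  exists t (x : {rmorphism R -> F}),
    [/\ (0 < t)%N, specialises iota x & (q ^ t).-primitive_root (x A)].
Proof.
move=> q_gt1 co_pq; have [K avoid_u] := primitive_avoids_roots nz_u.
have qK_gt0 : (0 < q ^ K.+1)%N by rewrite expn_gt0 ltnW.
have [alpha prim_alpha] := primitive_root_exists j p_pr qK_gt0 (coprimeXr _ co_pq).
have lt_Kq : (K < q ^ K.+1)%N by apply: ltn_trans (ltn_expl _ q_gt1).
have [x [xK xA]] := dom (avoid_u alpha _ lt_Kq prim_alpha).
by exists K.+1, x; rewrite xA.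
Qed.

Lemma primitive_neq0 n (z : F) : n.-primitive_root z -> z != 0.
Proof.
by move=> prim_z; rewrite (prim_root_eq0 prim_z) lt0n_neq0 ?(prim_order_gt0 prim_z).
Qed.

Hypothesis ordB : forall (x : {rmorphism R -> F}) n, specialises iota x ->
  n.-primitive_root (x A) -> x B ^+ n = 1.

Local Notation a := (tofrac A).
Local Notation b := (tofrac B).

Lemma tofrac_nonconstant (c : R) : ~ (exists d, c = iota d) -> tofrac c != 0.
Proof.
move=> c_nc; rewrite tofrac_eq0; apply/negP=> /eqP c0.
by apply: c_nc; exists 0; rewrite rmorph0.
Qed.

Lemma integral_power_relation i1 j1 i2 j2 :
    j1 != j2 -> A ^+ i1 * B ^+ j1 = A ^+ i2 * B ^+ j2 ->
  exists (v : nat) (k : int), (0 < v)%N /\ b ^+ v = a ^ k.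
Proof.
wlog lt_j : i1 j1 i2 j2 / (j2 < j1)%N.
  move=> IH ne_j rel; have [lt_j|lt_j|eq_j] := ltngtP j1 j2.
  - by apply: (IH i2 j2 i1 j1) => //; rewrite eq_sym.
  - exact: (IH i1 j1 i2 j2).
  - by rewrite eq_j eqxx in ne_j.
move=> _ rel; exists (j1 - j2)%N, (i2%:Z - i1%:Z); split; first by rewrite subn_gt0.
have nz_a := tofrac_nonconstant A_nc; have nz_b := tofrac_nonconstant B_nc.
rewrite expfzDr // -exprnP -exprnN.
have := congr1 (@tofrac R) rel; rewrite !tofracM !tofracXn => rel'.
apply: (mulIf (expf_neq0 j2 nz_b)); rewrite -exprD subnK ?(ltnW lt_j) //.
by apply: (mulfI (expf_neq0 i1 nz_a)); rewrite rel' mulrAC mulrCA mulfV ?expf_neq0 ?mulr1.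
Qed.

(** Let [v = v' p^m] with [v'] prime to [p]. An [x] with [x A] of order a power
    of [v'] and [x B = x A ^ s] gives [s v = k] modulo [v'], hence [v'] divides
    [k = k1 v']. Then [b ^ (p ^ m) / a ^ k1] is a [v']-th root of unity, so a
    constant [c]. An [x] with [x A] of order prime to [v'] shows that the order
    of [c] is prime to [v'] as well, and [c = 1]. *)
Lemma power_relation v k : (0 < v)%N -> b ^+ v = a ^ k ->
  exists (k1 : int) m, k1 != 0 /\ b ^+ (p ^ m) = a ^ k1.
Proof.
move=> v_gt0 Dbv; have nz_a := tofrac_nonconstant A_nc.
have [v' co_pv' Dv] := pfactor_coprime p_pr v_gt0; set m := logn p v in Dv.
have v'_gt0 : (0 < v')%N by move: v_gt0; rewrite Dv muln_gt0 => /andP[].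
have v'_k : (v' %| `|k|)%N.
  have [v'_gt1|] := ltnP 1 v'; last by case: (v') v'_gt0 => [|[]] // _ _; rewrite dvd1n.
  have [t [x [t_gt0 xK prim_x]]] := specialisation_of_order v'_gt1 co_pv'.
  have [s Ds] := prim_rootP prim_x (ordB xK prim_x).
  have rel_x : x B ^+ v = x A ^ k.
    rewrite (@eval_fraction_relation _ _ x A B 1 v k) ?rmorph1 ?mul1r //.
    exact: primitive_neq0 prim_x.
  apply: (@prim_expz_dvd _ _ v' (s * v) _ _ prim_x).
  - by rewrite exprM -Ds.
  - by rewrite -{1}[v']expn1 dvdn_exp2l.
  - by rewrite Dv dvdn_mull // dvdn_mulr.
have /dvdzP[k1 Dk] : (v' %| k)%Z by rewrite dvdzE.
have [c Dc] : exists c, b ^+ (p ^ m) / a ^ k1 = (@tofrac R \o iota) c.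
  apply: (@algebraic_constant F _ _ _ v') => //.
  rewrite exprMn -exprM mulnC -Dv Dbv exprVn (exprnP (a ^ k1)) exprz_exp -Dk.
  by rewrite mulfV // expfz_neq0.
have {}Dc : b ^+ (p ^ m) = tofrac (iota c) * a ^ k1.
  by rewrite (_ : tofrac (iota c) = b ^+ (p ^ m) / a ^ k1) ?divfK // expfz_neq0.
have cv' : c ^+ v' = 1.
  apply: (fmorph_inj (@tofrac R \o iota)); rewrite rmorph1 rmorphXn /=.
  apply: (mulIf (expfz_neq0 k nz_a)); rewrite mul1r -{2}Dbv Dv mulnC exprM Dc.
  by rewrite exprMn Dk -exprz_exp exprnP.
have c1 : c = 1.
  (* prime to both [p] and [v'] *)
  pose q := (p * v').+1.
  have co_v'q : coprime (p * v') q by rewrite /q coprimenS.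
  have q_gt1 : (1 < q)%N by rewrite ltnS muln_gt0 prime_gt0.
  have [|t [x [t_gt0 xK prim_x]]] := specialisation_of_order q_gt1.
    exact: coprime_dvdl (dvdn_mulr _ (dvdnn p)) co_v'q.
  have rel_x := eval_fraction_relation (primitive_neq0 prim_x) Dc.
  have cq : c ^+ (q ^ t) = 1.
    have /(congr1 (fun y => y ^+ (q ^ t))) := rel_x.
    rewrite xK exprMn -exprM mulnC exprM (ordB xK prim_x) expr1n.
    rewrite (exprnP (_ ^ k1)) exprz_exp (prim_expz_eq1 prim_x) ?mulr1 //.
    by rewrite abszM absz_nat dvdn_mull.
  have [d prim_c d_v'] := prim_order_exists v'_gt0 cv'.
  have d1 : (d %| gcdn v' (q ^ t))%N.
    by rewrite dvdn_gcd d_v' (prim_order_dvd prim_c) cq eqxx.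
  have := prim_expr_order prim_c.
  have co : coprime v' (q ^ t).
    by rewrite coprimeXr // (coprime_dvdl _ co_v'q) // dvdn_mull.
  by move: d1; rewrite (eqP co) dvdn1 => /eqP->; rewrite expr1.
exists k1, m; split; last by rewrite Dc c1 rmorph1 tofrac1 mul1r.
apply: contra_notN B_nc => /eqP k10.
apply: (@algebraic_constant F R iota B (p ^ m)); first by rewrite expn_gt0 prime_gt0.
by apply/eqP; rewrite -tofrac_eq tofracXn Dc c1 k10 rmorph1 !tofrac1 mul1r.
Qed.

(** If [k] had a factor [k'] prime to [p], then for [x A] of order a power of
    [k'] the element [x A ^ k = x B ^ (p ^ m)] would have a smaller order than
    [x B]. *)
Lemma primitive_power_relation (k : int) m :
    (forall (x : {rmorphism R -> F}) n, specialises iota x ->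
      n.-primitive_root (x A) -> n.-primitive_root (x B)) ->
    k != 0 -> b ^+ (p ^ m) = a ^ k ->
  exists s, `|k|%N = (p ^ s)%N.
Proof.
move=> primB nz_k Db.
have [k' co_pk' Dk] := pfactor_coprime p_pr (etrans (absz_gt0 k) nz_k).
exists (logn p `|k|); rewrite {1}Dk.
have k'_gt0 : (0 < k')%N by move: nz_k; rewrite -absz_gt0 Dk muln_gt0 => /andP[].
have [k'_gt1|] := ltnP 1 k'; last by case: (k') k'_gt0 => [|[]] // _ _; rewrite mul1n.
have [[|t] [x [// _ xK prim_x]]] := specialisation_of_order k'_gt1 co_pk'.
have rel_x : x B ^+ (p ^ m) = x A ^ k.
  rewrite (@eval_fraction_relation _ _ x A B 1 _ k) ?rmorph1 ?mul1r //.
  exact: primitive_neq0 prim_x.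
have : (x B ^+ (p ^ m)) ^+ (k' ^ t) = 1.
  rewrite rel_x exprnP exprz_exp (prim_expz_eq1 prim_x) //.
  by rewrite abszM absz_nat Dk expnS mulnAC dvdn_mulr.
rewrite -exprM => /eqP; rewrite -(prim_order_dvd (primB _ _ xK prim_x)).
rewrite Gauss_dvdr ?coprimeXl ?coprimeXr // 1?coprime_sym //.
by rewrite dvdn_Pexp2l // ltnn.
Qed.

Lemma frobenius_cases (k : int) m s :
    `|k|%N = (p ^ s)%N -> b ^+ (p ^ m) = a ^ k ->
  exists m : nat, [\/ b = a ^+ (p ^ m), b = a ^- (p ^ m), a = b ^+ (p ^ m)
    | a = b ^- (p ^ m)].
Proof.
move=> Dk Db.
have pK : p \in [pchar {fraction R}].
  by rewrite (fmorph_pchar (@tofrac R \o iota)) (pchar_closure j p_pr).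
have [y [Dy Dyk]] : exists y, (y = a \/ y = a^-1) /\ b ^+ (p ^ m) = y ^+ (p ^ s).
  case: k Dk Db => k Dk Db; first by exists a; rewrite Db -Dk -exprnP; split=> //; left.
  exists a^-1; rewrite Db -Dk NegzE -exprnN exprVn; split=> //; by right.
have [le_ms|lt_sm] := leqP m s.
  have {Dyk} Dby : b = y ^+ (p ^ (s - m)).
    apply: (frobenius_inj (r := m) pK); rewrite /= Dyk -exprM -expnD subnK //.
  exists (s - m)%N; case: Dy Dby => -> Dby; first by constructor 1.
  by constructor 2; rewrite -exprVn.
have {Dyk} Dby : y = b ^+ (p ^ (m - s)).
  by apply: (frobenius_inj (r := s) pK); rewrite /= -Dyk -exprM -expnD subnK // ltnW.
exists (m - s)%N; case: Dy Dby => -> Dby; first by constructor 3.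
by constructor 4; rewrite -Dby invrK.
Qed.
End PowerRelation.

(** * Divisibility and powers *)

Unset Implicit Arguments.

Theorem theorem2p4 (p : nat) (p_prime : prime p)
    (F : closedFieldType) (j : {rmorphism 'F_p -> F})
    (F_closure : is_algebraic_closure_of_Fp j)
    (d : nat) (C : {ffun 'I_d -> F} -> Prop)
    (C_curve : smooth_irreducible_affine_curve C)
    (R : idomainType) (iota : {rmorphism F -> R})
    (R_coord : is_coordinate_ring iota C)
    (A B : R)
    (A_notin_F : ~ exists c : F, A = iota c)
    (B_notin_F : ~ exists c : F, B = iota c)
    (N0 : nat) (N0_pos : (0 < N0)%N) :
  ((forall n : nat, (N0 < n)%N ->
      forall P : prime_idealr R, A ^+ n - 1 \in P -> B ^+ n - 1 \in P) ->
   exists (k : int) (m : nat),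
     k != 0 /\ tofrac B ^+ (p ^ m) = tofrac A ^ k)
  /\
  ((forall n : nat, (N0 < n)%N ->
      forall P : prime_idealr R,
        cyclotomic_value n A \in P -> cyclotomic_value n B \in P) ->
   exists m : nat,
     [\/ tofrac B = tofrac A ^+ (p ^ m),
         tofrac B = tofrac A ^- (p ^ m),
         tofrac A = tofrac B ^+ (p ^ m)
       | tofrac A = tofrac B ^- (p ^ m)]).
Proof.
have [C_closed C_irr [_ no_chain] _] := C_curve.
have [f nz_f f_AB] :=
  curve_algebraic_relation A C_closed C_irr no_chain R_coord B_notin_F.
have [pi [piC pi_surj _]] := R_coord.
have [u [nz_u dom]] := nonconstant_dominant piC pi_surj A_notin_F.
have power : (forall (x : {rmorphism R -> F}) n, specialises iota x ->
    n.-primitive_root (x A) -> x B ^+ n = 1) ->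
  exists (k : int) (m : nat), k != 0 /\ tofrac B ^+ (p ^ m) = tofrac A ^ k.
  move=> ordB.
  have [i1 [j1 [i2 [j2 [ne_j rel]]]]] :=
    multiplicative_relation p_prime F_closure A_notin_F nz_f f_AB nz_u dom ordB.
  have [v [k [v_gt0 Dbv]]] := integral_power_relation A_notin_F B_notin_F ne_j rel.
  exact: (power_relation j p_prime A_notin_F B_notin_F nz_u dom ordB v_gt0 Dbv).
split=> divides.
  apply: power => x n xK prim_x.
  have [P PE] := kernel_prime_ideal x.
  have x_pow N : (N0 < N)%N -> x A ^+ N = 1 -> x B ^+ N = 1.
    move=> lt_N AN; have := divides N lt_N P.
    rewrite !PE !rmorphB !rmorphXn !rmorph1 AN subrr eqxx subr_eq0.
    by move=> /(_ isT)/eqP.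
  have n_gt0 := prim_order_gt0 prim_x.
  have An k : x A ^+ (n * k) = 1 by rewrite exprM (prim_expr_order prim_x) expr1n.
  (* [n (N0 + 1)] and [n (N0 + 2)] are both large, and differ by [n] *)
  have Bn := x_pow _ (leq_pmull N0.+1 n_gt0) (An _).
  have := x_pow _ (ltnW (leq_pmull N0.+2 n_gt0)) (An _).
  by rewrite mulnS exprD Bn mulr1.
have primB (x : {rmorphism R -> F}) n : specialises iota x ->
    n.-primitive_root (x A) -> n.-primitive_root (x B).
  move=> xK prim_x; have [P PE] := kernel_prime_ideal x.
  have pF := pchar_closure j p_prime.
  have n_gt0 := prim_order_gt0 prim_x.
  have x_Phi N a : x (cyclotomic_value N a) = (map_poly intr 'Phi_N).[x a].
    rewrite -horner_map -map_poly_comp; congr (_.[_]).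
    by apply: eq_map_poly => c; apply: rmorph_int.
  apply: (cyclotomic_root_primitive (e := N0.+1) pF n_gt0).
    exact: primitive_coprime j p_prime _ _ prim_x.
  have lt_N : (N0 < n * p ^ N0.+1)%N.
    apply: leq_trans (leq_pmull _ n_gt0).
    exact: ltnW (ltn_expl N0.+1 (prime_gt1 p_prime)).
  have := divides _ lt_N P.
  rewrite !PE !x_Phi (primitive_cyclotomic_root pF N0 prim_x) eqxx.
  by move=> /(_ isT)/eqP.
have [|k [m [nz_k Db]]] := power.
  by move=> x n xK /(primB x n xK)/prim_expr_order.
have [s Dk] := primitive_power_relation j p_prime nz_u dom primB nz_k Db.
exact: (frobenius_cases j p_prime iota Dk Db).
Qed.
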